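(* Let $s\ge3$ and $m\ge2$ be integers, and let $S$ be a generalized-$\beta$-set such that $f(S)\ge f(S')$ for every generalized-$\beta$-set $S'$. Let $t=t(S)$. If $s$ is odd, then $t=\frac{s-1}{2}$ and one of the following holds: (1) $a_{(t-1)m+1}=\dots=a_{tm}=1$; (2) $a_{(t-1)m+1}=\dots=a_{tm-1}=2$ and $a_{tm}=1$. If $s$ is even, then $t=\frac{s}{2}$ and one of the following holds: (1) $a_{(t-1)m}=\dots=a_{tm-1}=1$; (2) $a_{(t-1)m+1}=\dots=a_{tm-1}=1$ and $a_{(t-1)m}=2$.
   Context: For a finite set $S$ of integers, $f(S)=\sum_{x\in S}x-\frac{|S|(|S|-1)}{2}$. Let $N=\lceil (s-1)/2\rceil m$. Define $\mathcal L_m(s)=\bigcup_{k=1}^mP_k$ with $P_k=\{\,i\,ms+j: i\ge0,\ (k-1)s+1+i\le j\le ks-1-i\,\}$ for $1\le k\le m-1$ and $P_m=\{\,i\,ms+j: i\ge0,\ (m-1)s+1+i\le j\le ms-2-i\,\}$. For a nonempty set $S\subseteq\{1,\dots,Ns-1\}$ let $t=t(S)=\min\{i\ge1: S\subseteq[0,ims-1]\}$, and for $1\le i\le N$ let $\mathcal B_i=S\cap[(i-1)s,is-1]$, $a_i=|\mathcal B_i|$, and $n_i=\max\{x\bmod s: x\in\mathcal B_i\}$ ($n_i=0$ if $\mathcal B_i=\emptyset$). A nonempty set $S\subseteq\mathcal L_m(s)$ is a generalized-$\beta$-set if: (1) for $1\le i<N$, $a_i=0$ implies $a_{i+1}=0$;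 (2) for $1\le i<tm$ with $m\nmid i$, $a_i\ge a_{i+1}$; (3) for $1\le i\le (t-1)m$ with $a_{i+m}>0$, $a_{i+m}\le a_i-2$; (4) for $1\le i<tm$ with $m\nmid i$ and $a_{i+1}>0$, $n_i\ge n_{i+1}$; (5) for $1\le i<tm$ with $m\nmid i$ and $a_i=a_{i+1}>0$, $n_i=n_{i+1}$; (6) if $t\ge2$, $a_{(t-1)m}\ge a_{(t-1)m+1}$. *)

(* Defs.v *)
From HB Require Import structures.
From mathcomp Require Import all_boot all_order all_algebra.
From mathcomp Require Import finmap.
From mathcomp Require Import zify.

Set Implicit Arguments.
Unset Strict Implicit.
Unset Printing Implicit Defensive.

(* All the sets involved consist of positive integers, so finite sets of
   integers are taken in [{fset nat}].  Bounds written with a subtraction on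
   paper are moved to the other side, since subtraction on [nat] truncates. *)

(* The division by 2 is exact; the value is in [int] because it is a difference. *)
Definition fval (S : {fset nat}) : int :=
  ((\sum_(x <- S) x)%N%:Z - ((#|` S| * #|` S|.-1) %/ 2)%N%:Z)%R.

(* uphalf n is the ceiling of n / 2. *)
Definition bigN (m s : nat) : nat := uphalf s.-1 * m.

Definition inP (m s k x : nat) : Prop :=
  exists i j : nat,
    [/\ x = i * (m * s) + j,
        k.-1 * s + 1 + i <= j
      & if k < m then j + 1 + i <= k * s else j + 2 + i <= k * s].

Definition inL (m s x : nat) : Prop :=
  exists2 k : nat, 1 <= k <= m & inP m s k x.

Definition within (m s : nat) (S : {fset nat}) (i : nat) : bool :=
  (1 <= i) && all (fun x => x < i * (m * s)) S.

(* [find] on an initial segment of nat returns the least element satisfying the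
   predicate; see [tmin_spec]. *)
Definition tmin (m s : nat) (S : {fset nat}) : nat :=
  find (within m s S) (iota 0 (bigN m s).+1).

Definition block (s : nat) (S : {fset nat}) (i : nat) : {fset nat} :=
  [fset x in S | i.-1 * s <= x < i * s]%fset.

Definition blk_card (s : nat) (S : {fset nat}) (i : nat) : nat :=
  #|` block s S i|.

(* The maximum over the empty block is 0. *)
Definition blk_max (s : nat) (S : {fset nat}) (i : nat) : nat :=
  \max_(x <- block s S i) (x %% s).

Record gen_beta_set (m s : nat) (S : {fset nat}) : Prop := GenBetaSet {
  gbs_neq0 : S != fset0;
  gbs_subL : forall x, x \in S -> inL m s x;
  gbs1 : forall i, 1 <= i < bigN m s ->
    blk_card s S i = 0 -> blk_card s S i.+1 = 0;
  gbs2 : forall i, 1 <= i < tmin m s S * m -> ~~ (m %| i) ->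
    blk_card s S i.+1 <= blk_card s S i;
  gbs3 : forall i, 1 <= i <= (tmin m s S).-1 * m ->
    0 < blk_card s S (i + m) -> blk_card s S (i + m) + 2 <= blk_card s S i;
  gbs4 : forall i, 1 <= i < tmin m s S * m -> ~~ (m %| i) ->
    0 < blk_card s S i.+1 -> blk_max s S i.+1 <= blk_max s S i;
  gbs5 : forall i, 1 <= i < tmin m s S * m -> ~~ (m %| i) ->
    blk_card s S i = blk_card s S i.+1 -> 0 < blk_card s S i.+1 ->
    blk_max s S i = blk_max s S i.+1;
  gbs6 : 2 <= tmin m s S ->
    blk_card s S ((tmin m s S).-1 * m).+1 <= blk_card s S ((tmin m s S).-1 * m)
}.

Lemma inL_bound (m s x : nat) :
  0 < m -> inL m s x -> 0 < x < bigN m s * s.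
Proof.
move=> m0 [k /andP[k1 km] [i [j [-> lo hi]]]].
have hi1 : j + 1 + i <= k * s by case: ifP hi => // _; lia.
have ks : k * s = k.-1 * s + s by case: (k) k1 => // k' _; rewrite mulSn addnC.
have is2 : 2 * i + 2 <= s by lia.
have iu : i.+1 <= uphalf s.-1 by lia.
have jm : j < m * s by apply: leq_trans (_ : k * s <= _); [lia | rewrite leq_mul2r km orbT].
apply/andP; split; first lia.
apply: leq_trans (_ : i.+1 * (m * s) <= _); first by rewrite mulSn; lia.
by rewrite /bigN -mulnA leq_mul2r iu orbT.
Qed.

Lemma tmin_spec (m s : nat) (S : {fset nat}) :
  0 < m -> 2 < s -> (forall x, x \in S -> inL m s x) ->
  within m s S (tmin m s S)
  /\ forall i, within m s S i -> tmin m s S <= i.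
Proof.
move=> m0 s2 SL.
have hN : within m s S (uphalf s.-1).
  apply/andP; split; first lia.
  by apply/allP => x /SL /(inL_bound m0) /andP[_]; rewrite /bigN mulnA.
have uN : uphalf s.-1 <= bigN m s by rewrite /bigN leq_pmulr.
have hh : has (within m s S) (iota 0 (bigN m s).+1).
  by apply/hasP; exists (uphalf s.-1); rewrite // mem_iota add0n ltnS.
split.
  have := nth_find 0 hh; rewrite nth_iota ?add0n //.
  by move: hh; rewrite has_find size_iota.
move=> i wi; rewrite leqNgt; apply/negP => lt_it.
have := before_find 0 lt_it; rewrite nth_iota ?add0n ?wi //.
apply: leq_trans lt_it _; rewrite -[X in _ <= X](size_iota 0).
exact: find_size.
Qed.

(* Main.v *)
(* Arrange the blocks in an array, a i k being the size of the block of index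
   i m + k + 1 (0 <= k < m).  For given sizes, f is largest when each block is
   filled from the largest admissible maximum downwards, so f becomes a function
   of the array.  If D elements are added to an optimal set of n elements
   (removed, if D < 0), then the sum of the elements grows by at most
   D (2 n + D - 1) / 2.  Comparing an addition with a removal elsewhere, this
   makes the sizes in each column decrease by exactly 2 per row.  The first empty
   block of positive capacity could then be opened by raising its column to
   1, 3, 5, ... counted from the top, which gains too much; hence the top row is
   as high as possible and full, and two adjacent columns of different height
   2 and 1 in it (other than the last) can be traded against each other. *)

Require Import Defs.
From HB Require Import structures.
From mathcomp Require Import all_boot all_order all_algebra.
From mathcomp Require Import finmap.
From mathcomp Require Import zify.

Set Implicit Arguments.
Unset Strict Implicit.
Unset Printing Implicit Defensive.

Import Order.TTheory GRing.Theory Num.Theory.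

(** * Arrays of block sizes *)

(** The size n of an optimal set is not known beforehand, and each comparison with a modified array
    only bounds it from one side. So n must be eliminated, by pairing an addition with a removal, or
    computed from the array. Opening the first empty block (v, K) uses both ways. If some column
    left of K drops by more than 2 from row v - 1 to row v, removing one element from each row below
    v bounds n from above. If there is no such column, condition (6) bounds all sizes in row v by
    the last live entry of column K, and n can be summed explicitly.

    The other obstacle is condition (5), which makes the value of a row more than a sum of
    independent blocks: a block as large as the last block of its row shares its smaller maximum.
    Enlarging the last block can therefore cost one unit for every element of other blocks. Every
    estimate for a move in the last column has to pay for this loss. *)

(* The maximum of a nonempty block of row i is at most s - 1 - i - dshift: the
   last block of a row is one shorter, and by condition (5) a block of the same
   size as the last one has the same maximum. *)
Definition dshift (m : nat) (r : nat -> nat) (k : nat) : nat :=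
  (k == m.-1) || (r k == r m.-1).

(* Twice the sum of the c largest admissible elements of block (i, k). *)
Definition blkw (m s i k c d : nat) : int :=
  (2 * c%:Z * (((i * m + k) * s + s)%N%:Z - (1 + i + d)%N%:Z) - c%:Z * (c%:Z - 1))%R.

Definition roww (m s i : nat) (r : nat -> nat) : int :=
  (\sum_(k < m) blkw m s i k (r k) (dshift m r k))%R.

Definition updr (r : nat -> nat) (K c : nat) (k : nat) : nat :=
  if k == K then c else r k.

Definition upd (a : nat -> nat -> nat) (K : nat) (c : nat -> nat) (i : nat) :=
  updr (a i) K (c i).

Definition cnt (m s : nat) (a : nat -> nat -> nat) : nat :=
  \sum_(i < s) \sum_(k < m) a i k.

(** Twice the value of f on the set whose blocks are filled downwards from their largest admissible
    maxima; doubling removes the division by 2. Summing over [s] rows suffices, since a nonempty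
    block in row i needs 2 i + 2 <= s. *)
Definition aval (m s : nat) (a : nat -> nat -> nat) : int :=
  (\sum_(i < s) roww m s i (a i) - (cnt m s a)%:Z * ((cnt m s a)%:Z - 1))%R.

(* The top row is u = t - 1; rows above it are empty. *)
Record feas (m s u : nat) (a : nat -> nat -> nat) : Prop := Feas {
  feas_pos : forall i k, i < u -> k < m -> 0 < a i k;
  feas_pos0 : 0 < a u 0;
  feas_zero : forall i k, u < i -> k < m -> a i k = 0;
  feas_row : forall i k, k.+1 < m -> a i k.+1 <= a i k;
  feas_col : forall i k, k < m -> 0 < a i.+1 k -> a i.+1 k + 2 <= a i k;
  feas_six : 0 < u -> a u 0 <= a u.-1 m.-1;
  feas_cap : forall i k, k < m -> 0 < a i k -> a i k + 2 * i + 1 + (k == m.-1) <= s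
}.

(** The competitors may have another top row, since opening a new row is one of the moves. *)
Definition opt (m s u : nat) (a : nat -> nat -> nat) : Prop :=
  feas m s u a /\
  forall u' a', feas m s u' a' -> (aval m s a' <= aval m s a)%R.

(** * Effect on one row of changing one block size *)

Lemma roww_updr_ge (m s i K c : nat) (r : nat -> nat) (E : int) :
  K < m ->
  (E <= blkw m s i K c (dshift m (updr r K c) K) - blkw m s i K (r K) (dshift m r K))%R ->
  (forall k, k < m -> k != K ->
     (blkw m s i k (r k) (dshift m r k) <= blkw m s i k (r k) (dshift m (updr r K c) k))%R) ->
  (E <= roww m s i (updr r K c) - roww m s i r)%R.
Proof.
move=> Km hE ho.
rewrite /roww (bigD1 (Ordinal Km)) //= [X in (_ - X)%R](bigD1 (Ordinal Km)) //=.
have : (\sum_(k < m | k != Ordinal Km) blkw m s i k (r k) (dshift m r k) <=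
  \sum_(k < m | k != Ordinal Km) blkw m s i k (updr r K c k) (dshift m (updr r K c) k))%R.
  apply: ler_sum => k kK.
  have kK' : (k : nat) != K by move: kK; rewrite -val_eqE.
  by rewrite {1}/updr (negbTE kK'); apply: ho.
have -> : updr r K c K = c by rewrite /updr eqxx.
have aux (e x y X Y : int) : (e <= x - y -> Y <= X -> e <= x + X - (y + Y))%R by lia.
exact: aux.
Qed.

(** The capacity keeps all new residues at or above 1 + i. If the block had the size of the last
    block, its maximum also rises by one and each of its [r K] old elements gains 1, which is the
    second term. *)
Lemma roww_raise (m s i K c : nat) (r : nat -> nat) :
  K.+1 < m -> r m.-1 <= r K -> r K < c -> c + 2 * i + 1 <= s ->
  (2 * (c%:Z - (r K)%:Z) * ((i * m + K) * s + 1 + i)%N%:Z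
     + 2 * (r K == r m.-1)%:Z * (r K)%:Z
   <= roww m s i (updr r K c) - roww m s i r)%R.
Proof.
move=> Km rl lt cap.
have Kn : (K == m.-1) = false by lia.
have Kn' : (m.-1 == K) = false by lia.
apply: roww_updr_ge; first lia.
  rewrite /dshift /updr eqxx Kn Kn' /=.
  have -> : (c == r m.-1) = false by lia.
  rewrite /blkw.
  move: (r K) lt rl => x lt rl.
  set B := (i * m + K) * s.
  case: (x == r m.-1) => /=; nia.
move=> k km kK; rewrite /dshift /updr (negbTE kK) Kn' //.
Qed.

(** Blocks of size [c] become as large as the last block, so their maximum falls and each of their
    [c] elements loses 1. Blocks that shared the old size of the last block can only gain. *)
Lemma roww_raise_last (m s i c : nat) (r : nat -> nat) :
  0 < m -> r m.-1 < c -> c + 2 * i + 2 <= s ->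
  (2 * (c%:Z - (r m.-1)%:Z) * ((i * m + m.-1) * s + 1 + i)%N%:Z
     - 2 * c%:Z * (\sum_(k < m.-1) (r k == c))%N%:Z
   <= roww m s i (updr r m.-1 c) - roww m s i r)%R.
Proof.
case: m => // m _ /= lt cap.
rewrite /roww !big_ord_recr /=.
rewrite [X in (_ + X - _)%R](_ : _ = blkw m.+1 s i m c 1); last first.
  by rewrite /dshift /updr /= eqxx.
rewrite [X in (_ - (_ + X))%R](_ : _ = blkw m.+1 s i m (r m) 1); last first.
  by rewrite /dshift /= eqxx.
have h1 : (2 * (c%:Z - (r m)%:Z) * ((i * m.+1 + m) * s + 1 + i)%N%:Z <=
   blkw m.+1 s i m c 1 - blkw m.+1 s i m (r m) 1)%R.
  rewrite /blkw; move: (r m) lt => x lt; set B := (i * m.+1 + m) * s; nia.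
have h2 : (\sum_(k < m) blkw m.+1 s i k (r k) (dshift m.+1 r k)
   <= \sum_(k < m) blkw m.+1 s i k (updr r m c k) (dshift m.+1 (updr r m c) k)
     + 2 * c%:Z * (\sum_(k < m) (r k == c))%N%:Z)%R.
  rewrite (big_morph Posz PoszD (erefl _)).
  rewrite mulr_sumr -big_split /=; apply: ler_sum => k _.
  have km : (k == m :> nat) = false by have := ltn_ord k; lia.
  rewrite /dshift /updr /= km eqxx /= /blkw.
  move: (nat_of_ord k) => k'; set B := (_ * s + s)%N.
  case: (r k' =P c) => [->|_] /=; first by case: (c == r m) => /=; nia.
  by case: (r k' == r m) => /=; nia.
have aux (x z A B X Y : int) :
  (x <= A - B -> Y <= X + z -> x - z <= X + A - (Y + B))%R by lia.
exact: aux h1 h2.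
Qed.

(** At most the largest residue s - 1 - i is lost. Usually the smallest element goes; if the block
    drops to the size of the last block, its maximum falls too, which amounts to removing its
    largest element. *)
Lemma roww_lower (m s i K c : nat) (r : nat -> nat) :
  K < m -> r K = c.+1 -> (K.+1 < m -> r m.-1 < r K) -> (forall k, k < m -> r m.-1 <= r k) ->
  (- 2 * (((i * m + K) * s + s)%N%:Z - 1 - i%:Z)
   <= roww m s i (updr r K c) - roww m s i r)%R.
Proof.
move=> Km rK hlt hmin.
apply: roww_updr_ge => //.
  rewrite rK /blkw; set B := (_ * s + s)%N.
  rewrite /dshift /updr eqxx rK.
  case: eqP => [e|e] /=; first nia.
  have -> : (c.+1 == r m.-1) = false by have := hlt; lia.
  by case: (c == _) => /=; nia.
move=> k km kK; rewrite /dshift /updr (negbTE kK) /blkw.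
set B := (_ * s + s)%N.
case: (k =P m.-1) => //= kl.
case: (m.-1 =P K) => [e|//].
have -> : (r k == c) = false by have := hmin k km; rewrite e rK; lia.
by case: (r k == _) => /=; nia.
Qed.

Lemma roww_ext (m s i : nat) (r r' : nat -> nat) :
  (forall k, r k = r' k) -> roww m s i r = roww m s i r'.
Proof. by move=> h; apply: eq_bigr => k _; rewrite /dshift !h. Qed.

Lemma updr_id (r : nat -> nat) (K k : nat) : updr r K (r K) k = r k.
Proof. by rewrite /updr; case: eqP => [->|]. Qed.

Lemma feas_row_le (m s u : nat) (a : nat -> nat -> nat) (i k k' : nat) :
  feas m s u a -> k <= k' -> k' < m -> a i k' <= a i k.
Proof.
move=> fa; elim: k' => [|k' IH] kk km; first by have -> : k = 0 by lia.
case: (k =P k'.+1) => [->//|ne].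
by apply: leq_trans (feas_row fa i km) _; apply: IH; lia.
Qed.

Lemma roww_upd_raise (m s u u' K : nat) (a : nat -> nat -> nat) (c : nat -> nat) (i : nat) :
  feas m s u a -> feas m s u' (upd a K c) -> K.+1 < m -> a i K <= c i ->
  (2 * ((c i)%:Z - (a i K)%:Z) * ((i * m + K) * s + 1 + i)%N%:Z
     + 2 * ((c i != a i K) && (a i K == a i m.-1))%:Z * (a i K)%:Z
   <= roww m s i (upd a K c i) - roww m s i (a i))%R.
Proof.
move=> fa fu Km; case: ltngtP => // [lt|e] _ /=.
  apply: roww_raise => //; first by apply: (feas_row_le _ fa); lia.
  by have := feas_cap fu (i := i) (k := K); rewrite /upd /updr eqxx; lia.
rewrite (_ : roww m s i (upd a K c i) = roww m s i (a i)) ?subrr ?e ?subrr; first lia.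
by apply: roww_ext => k; rewrite /upd -e updr_id.
Qed.

Lemma roww_upd_raise_last (m s u u' : nat) (a : nat -> nat -> nat) (c : nat -> nat) (i : nat) :
  0 < m -> feas m s u a -> feas m s u' (upd a m.-1 c) -> a i m.-1 <= c i ->
  (2 * ((c i)%:Z - (a i m.-1)%:Z) * ((i * m + m.-1) * s + 1 + i)%N%:Z
     - 2 * (c i != a i m.-1)%:Z * ((c i)%:Z * (\sum_(k < m.-1) (a i k == c i))%N%:Z)
   <= roww m s i (upd a m.-1 c i) - roww m s i (a i))%R.
Proof.
move=> m0 fa fu; case: ltngtP => // [lt|e] _ /=.
  have := @roww_raise_last m s i (c i) (a i) m0 lt.
  have := feas_cap fu (i := i) (k := m.-1); rewrite /upd /updr !eqxx => h.
  have h' : c i + 2 * i + 2 <= s by lia.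
  by move=> /(_ h'); rewrite mulr1 mulrA.
rewrite (_ : roww m s i (upd a m.-1 c i) = roww m s i (a i)) ?subrr ?e ?subrr; first lia.
by apply: roww_ext => k; rewrite /upd -e updr_id.
Qed.

Lemma roww_upd_lower (m s u u' K : nat) (a : nat -> nat -> nat) (c : nat -> nat) (i : nat) :
  feas m s u a -> feas m s u' (upd a K c) -> K < m -> c i <= a i K <= (c i).+1 ->
  (2 * ((c i)%:Z - (a i K)%:Z) * (((i * m + K) * s + s)%N%:Z - 1 - i%:Z)
   <= roww m s i (upd a K c i) - roww m s i (a i))%R.
Proof.
move=> fa fu Km /andP[]; case: ltngtP => // [lt|e] _ h /=.
  have e : a i K = (c i).+1 by lia.
  have -> : (2 * ((c i)%:Z - (a i K)%:Z) = - 2 :> int)%R by rewrite e; lia.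
  apply: roww_lower => // [Km'|k km]; last by apply: (feas_row_le _ fa); lia.
  have := @feas_row_le _ _ _ _ i K m.-1 fu; rewrite /upd /updr eqxx.
  by case: eqP; lia.
rewrite (_ : roww m s i (upd a K c i) = roww m s i (a i)) ?subrr ?e ?subrr; first lia.
by apply: roww_ext => k; rewrite /upd e updr_id.
Qed.

(** * Changing one column of an optimal array *)

Lemma cnt_upd (m s K : nat) (a : nat -> nat -> nat) (c : nat -> nat) :
  K < m ->
  ((cnt m s (upd a K c))%:Z
   = (cnt m s a)%:Z + \sum_(i < s) ((c i)%:Z - (a i K)%:Z))%R.
Proof.
move=> Km; rewrite /cnt !(big_morph Posz PoszD (erefl _)) -big_split /=.
apply: eq_bigr => i _.
rewrite (bigD1 (Ordinal Km)) //= [in RHS](bigD1 (Ordinal Km)) //= /upd /updr eqxx.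
rewrite [X in (c i + X)%N](eq_bigr (fun k : 'I_m => a i k)); last first.
  by move=> k kK; have -> : (k == K :> nat) = false by move: kK; rewrite -val_eqE => /negbTE.
lia.
Qed.

(** The term n (n - 1) subtracted in [aval] grows by D (2 n + D - 1) when n grows by D, and
    optimality forbids the rows to gain more. Any convenient lower bounds [rho] of the row gains can
    be used. *)
Lemma opt_upd (m s u u' K : nat) (a : nat -> nat -> nat) (c : nat -> nat)
    (rho : nat -> int) (D : int) :
  opt m s u a -> K < m -> feas m s u' (upd a K c) ->
  (forall i, i < s -> (rho i <= roww m s i (upd a K c i) - roww m s i (a i))%R) ->
  (\sum_(i < s) ((c i)%:Z - (a i K)%:Z) = D)%R ->
  (\sum_(i < s) rho i <= D * (2 * (cnt m s a)%:Z + D - 1))%R.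
Proof.
move=> [fa ha] Km fu hr hD.
have h1 : (\sum_(i < s) rho i <=
  \sum_(i < s) roww m s i (upd a K c i) - \sum_(i < s) roww m s i (a i))%R.
  by rewrite -sumrB; apply: ler_sum => i _; apply: hr.
have := ha _ _ fu; rewrite /aval (cnt_upd s a c Km) hD.
have aux (x A B n : int) : (x <= A - B -> A - (n + D) * (n + D - 1) <= B - n * (n - 1)
   -> x <= D * (2 * n + D - 1))%R by nia.
exact: aux h1.
Qed.

Lemma sum_single (s i0 : nat) (X : int) :
  i0 < s -> (\sum_(i < s) (if i == i0 :> nat then X else 0) = X)%R.
Proof.
move=> lt; rewrite -big_mkcond (big_pred1 (Ordinal lt)) //.
Qed.

Lemma big_below (R : Type) (idx : R) (op : Monoid.law idx) (s t : nat) (F : nat -> R) :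
  t <= s -> (forall i, t <= i -> F i = idx) ->
  \big[op/idx]_(i < s) F i = \big[op/idx]_(i < t) F i.
Proof.
move=> ts F0; rewrite -!(big_mkord xpredT) (big_cat_nat (n := t)) //=.
rewrite [X in op _ X]big_nat [X in op _ X]big1 ?Monoid.mulm1 // => i /andP[ti _].
exact: F0.
Qed.

Lemma sum_affine (t : nat) (A B : int) :
  (2 * \sum_(i < t) (A + B * i%:Z) = 2 * t%:Z * A + B * t%:Z * (t%:Z - 1))%R.
Proof.
elim: t => [|t IH]; first by rewrite big_ord0; lia.
by rewrite big_ord_recr /= mulrDr IH; lia.
Qed.

(** The summand [K * (a i0 K).+1] is a uniform price for condition (5): if [K] is the last column,
    at most [K] blocks lose [(a i0 K).+1] each, and otherwise nothing is lost. *)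
Lemma opt_raise1 (m s u u' K i0 : nat) (a : nat -> nat -> nat) :
  opt m s u a -> K < m -> i0 < s ->
  feas m s u' (upd a K (fun i => a i K + (i == i0))) ->
  i0 * m * s + K * s + 1 + i0 <= cnt m s a + K * (a i0 K).+1.
Proof.
move=> oa Km i0s fu; have [fa _] := oa.
pose c i := a i K + (i == i0).
pose X : int := (2 * (i0 * m * s + K * s + 1 + i0)%N%:Z - 2 * (K * (a i0 K).+1)%N%:Z)%R.
have := @opt_upd _ _ _ _ _ _ c (fun i => if i == i0 then X else 0%R) 1 oa Km fu.
rewrite sum_single //; move=> h.
have {h} : (X <= 1 * (2 * (cnt m s a)%:Z + 1 - 1))%R.
  apply: h; last first.
    rewrite -[RHS](sum_single 1 i0s); apply: eq_bigr => i _; rewrite /c.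
    by case: eqP; lia.
  move=> i _; case: (i =P i0) => [->|ne]; last first.
    rewrite (_ : roww m s i (upd a K c i) = roww m s i (a i)) ?subrr //.
    by apply: roww_ext => k; rewrite /upd /c; case: eqP ne => //; rewrite addn0 updr_id.
  have cE : c i0 = (a i0 K).+1 by rewrite /c eqxx addn1.
  case: (ltnP K.+1 m) => Km'.
    have := roww_upd_raise (i := i0) fa fu Km' (leq_addr _ _).
    rewrite -/c -/(c i0) cE; apply: le_trans.
    by rewrite /X; nia.
  have KE : K = m.-1 by lia.
  subst K.
  have m0 : 0 < m by lia.
  have := roww_upd_raise_last (i := i0) m0 fa fu (leq_addr _ _).
  rewrite -/c -/(c i0) cE; apply: le_trans.
  have hb : \sum_(k < m.-1) (a i0 k == (a i0 m.-1).+1) <= m.-1.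
    by rewrite -[X in _ <= X]muln1 -[X in _ <= X * _]card_ord -sum_nat_const leq_sum // => k _; case: eqP.
  move: hb; set g := \sum_(k < _) _ => hb.
  have -> : ((a i0 m.-1).+1 != a i0 m.-1) = true by lia.
  rewrite /X; move: (a i0 m.-1) => x; nia.
rewrite /X; lia.
Qed.

Lemma opt_lower1 (m s u u' K i0 : nat) (a : nat -> nat -> nat) :
  opt m s u a -> K < m -> i0 < s -> 0 < a i0 K ->
  feas m s u' (upd a K (fun i => a i K - (i == i0))) ->
  cnt m s a + i0 <= (i0 * m + K) * s + s.
Proof.
move=> oa Km i0s pos fu; have [fa _] := oa.
pose c i := a i K - (i == i0).
pose X : int := (- 2 * (((i0 * m + K) * s + s)%N%:Z - 1 - i0%:Z))%R.
have := @opt_upd _ _ _ _ _ _ c (fun i => if i == i0 then X else 0%R) (-1) oa Km fu.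
rewrite sum_single //; move=> h.
have {h} : (X <= (-1) * (2 * (cnt m s a)%:Z + (-1) - 1))%R.
  apply: h; last first.
    rewrite -[RHS](sum_single (-1) i0s); apply: eq_bigr => i _; rewrite /c.
    by case: eqP => [->|]; lia.
  move=> i _; case: (i =P i0) => [->|ne]; last first.
    rewrite (_ : roww m s i (upd a K c i) = roww m s i (a i)) ?subrr //.
    by apply: roww_ext => k; rewrite /upd /c; case: eqP ne => //; rewrite subn0 updr_id.
  have := roww_upd_lower (i := i0) fa fu Km.
  have cE : c i0 = (a i0 K).-1 by rewrite /c eqxx subn1.
  rewrite -/c -/(c i0) cE => h; apply: le_trans (h _); last lia.
  by rewrite /X; nia.
rewrite /X; lia.
Qed.

Lemma feas_upd (m s u u' K : nat) (a : nat -> nat -> nat) (c : nat -> nat) :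
  1 < m -> feas m s u a -> K < m -> u <= u' ->
  (forall i k, i < u' -> k < m -> k != K -> 0 < a i k) ->
  (forall i, i < u' -> 0 < c i) ->
  0 < (if K == 0 then c u' else a u' 0) ->
  (forall i, u' < i -> c i = 0) ->
  (forall i, 0 < K -> c i <= a i K.-1) ->
  (forall i, K.+1 < m -> a i K.+1 <= c i) ->
  (forall i, 0 < c i.+1 -> c i.+1 + 2 <= c i) ->
  (0 < u' -> (if K == 0 then c u' else a u' 0)
             <= (if K == m.-1 then c u'.-1 else a u'.-1 m.-1)) ->
  (forall i, 0 < c i -> c i + 2 * i + 1 + (K == m.-1) <= s) ->
  feas m s u' (upd a K c).
Proof.
move=> m1 fa Km uu hp hcp h0 hz hl hr hc h6 hcap.
split; rewrite /upd /updr.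
- by move=> i k iu km; case: eqP => [_|/eqP ne]; [apply: hcp | apply: hp].
- by move: h0; rewrite eq_sym.
- move=> i k ui km; case: eqP => _; first exact: hz.
  by apply: (feas_zero fa) => //; lia.
- move=> i k km; case: eqP => [e|ne].
    by subst K; have -> : (k == k.+1) = false by [lia]; apply: (hl i).
  case: eqP => [e|_]; first by subst k; apply: hr.
  exact: (feas_row fa).
- move=> i k km; case: eqP => [_|_]; first exact: hc.
  exact: (feas_col fa).
- by rewrite [0 == K]eq_sym [m.-1 == K]eq_sym.
- move=> i k km; case: eqP => [->|_]; first exact: hcap.
  exact: (feas_cap fa).
Qed.

(** To keep a row weakly decreasing, an element may be added only at the left end of a run of equal
    sizes and removed only at its right end. This lemma and the next one find these ends. *)
Lemma row_left (r : nat -> nat) (k : nat) :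
  (forall j, j < k -> r j.+1 <= r j) ->
  exists k', [/\ k' <= k, r k' = r k & (0 < k' -> r k' < r k'.-1)].
Proof.
elim: k => [|k IH] h; first by exists 0.
case: (r k =P r k.+1) => [e|ne].
  have [|k' [kk' e' h']] := IH; first by move=> j jk; apply: h; lia.
  by exists k'; split=> //; [lia | rewrite e'].
exists k.+1; split=> // _ /=.
by have := h k (ltnSn k); lia.
Qed.

Lemma row_right (r : nat -> nat) (k m : nat) :
  k < m -> (forall j, j.+1 < m -> r j.+1 <= r j) ->
  exists k', [/\ k <= k' < m, r k' = r k & (k'.+1 < m -> r k'.+1 < r k')].
Proof.
move=> km h; move: {2}(m - k) (leqnn (m - k)) => n; elim: n k km => [|n IH] k km hn; first lia.
case: (ltnP k.+1 m) => km'; last by exists k; split=> //; lia.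
case: (r k.+1 =P r k) => [e|ne].
  have [|k' [kk' e' h']] := IH k.+1 km'; first lia.
  by exists k'; split=> //; [lia | rewrite e'].
exists k; split=> // [|_]; first lia.
by have := h k km'; lia.
Qed.

Lemma feas_live_bound (m s u : nat) (a : nat -> nat -> nat) :
  1 < m -> feas m s u a -> 2 * u + 2 <= s.
Proof.
move=> m1 fa; have := feas_cap fa (i := u) (k := 0).
by have := feas_pos0 fa; lia.
Qed.

(* Where the row i+1 is poorer than the column condition allows, one element
   can be added to row i+1 and one removed from row i; since every element of
   row i+1 exceeds every element of row i, one of the two moves gains. *)
Lemma opt_no_jump (m s u i k : nat) (a : nat -> nat -> nat) :
  1 < m -> opt m s u a -> i.+1 <= u -> k < m -> 0 < a i.+1 k ->
  (i.+1 < u \/ a u 0 < a i m.-1) ->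
  a i k = a i.+1 k + 2.
Proof.
move=> m1 oa iu km pos h6; have [fa _] := oa.
have us := feas_live_bound m1 fa.
apply/eqP/negPn/negP => ne.
have jump : a i.+1 k + 2 < a i k by have := feas_col fa km pos; lia.
have [k1 [k1k e1 l1]] : exists k', [/\ k' <= k, a i.+1 k' = a i.+1 k
    & (0 < k' -> a i.+1 k' < a i.+1 k'.-1)].
  by apply: row_left => j jk; apply: (feas_row fa); lia.
have [k2 [k2k e2 l2]] : exists k', [/\ k <= k' < m, a i k' = a i k
    & (k'.+1 < m -> a i k'.+1 < a i k')].
  by apply: row_right => // j jk; apply: (feas_row fa).
have ge1 : a i k <= a i k1 by apply: (feas_row_le _ fa); lia.
have le2 : a i.+1 k2 <= a i.+1 k by apply: (feas_row_le _ fa); lia.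
have lastle : a i m.-1 <= a i k2 by apply: (feas_row_le _ fa); lia.
have hpos : forall j l, j < u -> l < m -> 0 < a j l by exact: (feas_pos fa).
have cap1 := feas_cap fa (i := i) (k := k1).
have c1 : k1 < m by lia.
have f1 : feas m s u (upd a k1 (fun j => a j k1 + (j == i.+1))).
  apply: (feas_upd _ fa) => //.
  - by move=> j l ju lm _; apply: hpos.
  - by move=> j ju; have := hpos j k1 ju c1; lia.
  - by have := feas_pos0 fa; case: eqP => // ->; lia.
  - move=> j ju; rewrite (feas_zero fa) //; lia.
  - move=> j k0; case: eqP => [->|_]; first by have := l1 k0; lia.
    by rewrite addn0; apply: (feas_row_le _ fa); lia.
  - by move=> j km'; have := feas_row fa j km'; lia.
  - move=> j; case: (j.+1 =P i.+1) => [[->]|_].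
      have -> : (i == i.+1) = false by lia.
      by move=> _; lia.
    by rewrite addn0 => p; have := feas_col fa c1 p; lia.
  - move=> u0; have := feas_six fa u0.
    case: (k1 =P 0) => [k10|_]; last by case: (k1 =P m.-1) => [->|]; lia.
    have -> : (k1 == m.-1) = false by lia.
    (* If the raised block is the first one of the top row, condition (6) survives because of the
       strict inequality in [h6]. *)
    move: h6; case: (u =P i.+1) => [->|] /=; rewrite k10; lia.
  - move=> j; case: (j =P i.+1) => [->|_] p; first by move: cap1; lia.
    by have := feas_cap fa (i := j) c1; lia.
have c2 : k2 < m by lia.
have f2 : feas m s u (upd a k2 (fun j => a j k2 - (j == i))).
  apply: (feas_upd _ fa) => //.
  - by move=> j l ju lm _; apply: hpos.
  - move=> j ju; have := hpos j k2 ju c2; case: eqP => [->|]; lia.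
  - have := feas_pos0 fa; case: eqP => // ->; case: eqP; lia.
  - move=> j ju; rewrite (feas_zero fa) //.
  - move=> j k0; apply: leq_trans (leq_subr _ _) _.
    by apply: (feas_row_le _ fa); lia.
  - move=> j km'; case: eqP => [->|_]; first by have := l2 km'; lia.
    by rewrite subn0; apply: (feas_row fa).
  - move=> j; case: (j =P i) => [->|_].
      have -> : (i.+1 == i) = false by lia.
      by move=> _; lia.
    by move=> p; have := feas_col fa (i := j) c2; lia.
  - move=> u0; have := feas_six fa u0.
    case: (k2 =P m.-1) => [k2m|_]; last by case: (k2 =P 0) => [->|]; lia.
    have -> : (k2 == 0) = false by lia.
    move: h6; case: (u.-1 =P i) => [<-|]; rewrite k2m; lia.
  - by move=> j p; have := feas_cap fa (i := j) c2; lia.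
have i1s : i.+1 < s by lia.
have is_ : i < s by lia.
have p2 : 0 < a i k2 by lia.
have := opt_raise1 oa c1 i1s f1.
have := opt_lower1 oa c2 is_ p2 f2.
(* The price of condition (5) is at most [k1 * s], so the offset [k1 * s] of the block in its row
   absorbs it. *)
have capx : k1 * (a i.+1 k1).+1 <= k1 * s by rewrite leq_mul2l; lia.
have k2s : k2 * s + s <= m * s by rewrite -mulSnr leq_mul2r; lia.
rewrite mulnDl !mulSn mulnDl; lia.
Qed.

(** * The first empty block *)

(* (v, K) is the first empty block, in the order of the block indices, and has
   positive capacity; it lies in a new row if the top row u has no empty block. *)
Record first_dead (m s u : nat) (a : nat -> nat -> nat) (v K : nat) : Prop := FirstDead {
  fd_col : K < m;
  fd_live : forall i k, i < v -> k < m -> 0 < a i k;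
  fd_pre : forall k, k < K -> 0 < a v k;
  fd_dead : forall k, K <= k -> k < m -> a v k = 0;
  fd_top : v = if K == 0 then u.+1 else u;
  fd_cap : 2 * v + 2 + (K == m.-1) <= s
}.

Lemma cnt_split (m s u v : nat) (a : nat -> nat -> nat) :
  feas m s u a -> u <= v -> v < s ->
  cnt m s a = \sum_(i < v) (\sum_(k < m) a i k) + \sum_(k < m) a v k.
Proof.
move=> fa uv vs; rewrite /cnt (@big_below _ _ _ s v.+1 (fun i => \sum_(k < m) a i k)) //.
  by rewrite big_ord_recr.
by move=> i vi; rewrite big1 // => k _; apply: (feas_zero fa) => //; lia.
Qed.

(** The term [g] records by how much the first [K] summands fall short of [P]. *)
Lemma sum_two_parts (m K P Q : nat) (h g : nat -> nat) :
  K <= m -> (forall k, k < K -> h k + g k <= P) ->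
  (forall k, K <= k -> k < m -> h k <= Q) ->
  \sum_(k < m) h k + \sum_(k < K) g k <= K * P + (m - K) * Q.
Proof.
move=> Km h1 h2.
rewrite -(big_mkord xpredT h) (big_cat_nat (n := K)) //= big_mkord addnAC -big_split /=.
apply: leq_add.
  apply: leq_trans (_ : \sum_(k < K) P <= _); first by apply: leq_sum => k _; apply: h1.
  by rewrite sum_nat_const card_ord.
apply: leq_trans (_ : \sum_(K <= k < m) Q <= _); last by rewrite sum_nat_const_nat.
by rewrite !big_nat; apply: leq_sum => k /andP[]; apply: h2.
Qed.

(** If v = 0, or if the block below has size at least 3, a single element could be put into (v, K).
    It would gain: the rows below hold at most v m s elements and each of the [K] blocks before it
    in its row fewer than s. *)
Lemma fd_blocked (m s u v K : nat) (a : nat -> nat -> nat) :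
  1 < m -> opt m s u a -> first_dead m s u a v K -> 0 < v /\ a v.-1 K <= 2.
Proof.
move=> m1 oa fd; have [fa _] := oa.
have [Km live pre dead top cap] := fd.
have uv : u <= v by rewrite top; case: eqP; lia.
suff : ~ (0 < v -> 2 < a v.-1 K).
  by move=> h; split; [case: v h {fd live pre dead top cap uv} => // -[] | rewrite leqNgt; apply/negP => h'; apply: h].
move=> hbig.
have f1 : feas m s v (upd a K (fun i => a i K + (i == v))).
  apply: (feas_upd _ fa) => //.
  - by move=> i k iv km _; apply: live.
  - by move=> i iv; have := live i K iv Km; lia.
  - by case: (K =P 0) => [_|ne]; [lia | apply: pre; lia].
  - by move=> i vi; rewrite (feas_zero fa) //; lia.
  - move=> i K0; case: (i =P v) => [->|_].
      by rewrite dead //; apply: pre; lia.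
    by rewrite addn0; apply: (feas_row_le _ fa); lia.
  - by move=> i Km'; have := feas_row fa i Km'; lia.
  - move=> i; case: (i.+1 =P v) => [e|_].
      by rewrite e dead // => _; have := hbig; rewrite -e /=; lia.
    by rewrite addn0 => p; have := feas_col fa Km p; lia.
  - move=> v0; case: (K =P 0) => [K0|K0].
      have -> : (K == m.-1) = false by lia.
      by rewrite dead // eqxx; apply: live; lia.
    have vu : v = u by rewrite top; case: eqP.
    have := feas_six fa; rewrite -vu => /(_ v0).
    by case: (K =P m.-1) => [->|]; lia.
  - move=> i; case: (i =P v) => [->|_] p; last by have := feas_cap fa (i := i) Km; lia.
    by rewrite dead //; lia.
have vs : v < s by lia.
have := opt_raise1 oa Km vs f1; rewrite (dead K) //.
rewrite (cnt_split fa uv vs).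
have b1 : \sum_(i < v) \sum_(k < m) a i k <= v * (m * s).
  apply: leq_trans (_ : \sum_(i < v) m * s <= _); last by rewrite sum_nat_const card_ord.
  apply: leq_sum => i _; apply: leq_trans (_ : \sum_(k < m) s <= _); last by rewrite sum_nat_const card_ord.
  by apply: leq_sum => k _; have := feas_cap fa (i := i) (ltn_ord k); lia.
have b2 : \sum_(k < m) a v k + \sum_(k < K) 1 <= K * s + (m - K) * 0.
  apply: (@sum_two_parts m K s 0 (a v) (fun=> 1)); first lia.
    by move=> k kK; have := feas_cap fa (i := v) (k := k); have := pre k kK; lia.
  by move=> k k1 k2; rewrite dead.
move: b2; rewrite sum_nat_const card_ord.
move: b1; lia.
Qed.

Lemma fd_const (m s u v K : nat) (a : nat -> nat -> nat) (i k : nat) :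
  1 < m -> opt m s u a -> first_dead m s u a v K -> i < v -> k < m ->
  a i k = a v.-1 k + 2 * (v.-1 - i).
Proof.
move=> m1 oa fd iv km; have [fa _] := oa.
have [_ bl] := fd_blocked m1 oa fd.
have [Km live pre dead top cap] := fd.
have step j : j.+1 < v -> a j k = a j.+1 k + 2.
  move=> jv; apply: (opt_no_jump m1 oa) => //; first by move: top; case: eqP; lia.
    exact: live.
  move: top; case: (K =P 0) => [K0|_] top; last by left; lia.
  case: (ltnP j.+1 u) => ju; first by left.
  (* Here [K] is 0 and [j] is the row just below the top: [a u 0] is at most 2, while the last block
     of row [j] has at least 1 + 2 elements. *)
  right; have e : u = j.+1 by lia.
  have lm : m.-1 < m by lia.
  have := feas_col fa (i := j) lm; rewrite -e.
  have := live u m.-1; have : a u 0 <= 2 by move: bl; rewrite top K0 /=.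
  lia.
have key d : forall j, j + d = v.-1 -> a j k = a v.-1 k + 2 * d.
  elim: d => [|d IH] j e; first by rewrite muln0 addn0 -e addn0.
  by rewrite step; [rewrite (IH j.+1); lia | lia].
by apply: key; lia.
Qed.

Lemma fd_cnt (m s u v K : nat) (a : nat -> nat -> nat) :
  1 < m -> opt m s u a -> first_dead m s u a v K ->
  cnt m s a = \sum_(k < m) (v * a v.-1 k + a v k) + m * v * v.-1.
Proof.
move=> m1 oa fd; have [fa _] := oa.
have [v0 _] := fd_blocked m1 oa fd.
have uv : u <= v by rewrite (fd_top fd); case: eqP; lia.
have vs : v < s by have := fd_cap fd; lia.
rewrite (cnt_split fa uv vs) big_split /= -big_distrr /=.
set al := \sum_(k < m) a v.-1 k.
suff -> : \sum_(i < v) \sum_(k < m) a i k = v * al + m * v * v.-1 by lia.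
have -> : \sum_(i < v) \sum_(k < m) a i k = \sum_(i < v) (al + m * (2 * (v.-1 - i))).
  apply: eq_bigr => i _; rewrite /al -[X in (_ + X * _)%N]card_ord -sum_nat_const -big_split /=.
  by apply: eq_bigr => k _; rewrite (fd_const m1 oa fd).
suff : (2 * (\sum_(i < v) (al + m * (2 * (v.-1 - i))))%N%:Z = 2 * (v * al + m * v * v.-1)%N%:Z)%R by lia.
rewrite (big_morph Posz PoszD (erefl _)).
rewrite (eq_bigr (fun i : 'I_v => (al%:Z + 2 * m%:Z * v.-1%:Z) + (- 2 * m%:Z) * i%:Z)%R); last first.
  by move=> i _; have := ltn_ord i; nia.
rewrite sum_affine; nia.
Qed.

(* If some column left of the first dead block has slack, one element can be
   removed from each row of it, and optimality bounds the number of elements. *)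
Lemma fd_lower (m s u v K k : nat) (a : nat -> nat -> nat) :
  1 < m -> opt m s u a -> first_dead m s u a v K -> k < K ->
  a v k + 2 < a v.-1 k -> 2 * cnt m s a <= v.-1 * m * s + 2 * K * s.
Proof.
move=> m1 oa fd kK jump; have [fa _] := oa.
have [v0 bl] := fd_blocked m1 oa fd.
have [Km live pre dead top cap] := fd.
have vu : v = u by rewrite top; case: eqP; lia.
have vs : v < s by lia.
have [k2 [k2k e2 l2]] : exists k', [/\ k <= k' < m, a v.-1 k' = a v.-1 k
    & (k'.+1 < m -> a v.-1 k'.+1 < a v.-1 k')].
  by apply: row_right => [|j jk]; [lia | apply: (feas_row fa)].
(* The run has size at least 4, whereas [a v.-1 K] is at most 2. *)
have k2K : k2 < K.
  rewrite ltnNge; apply/negP => Kk2.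
  have := @feas_row_le _ _ _ _ v.-1 K k2 fa Kk2; have := pre k kK; lia.
have c2 : k2 < m by lia.
have cst := fd_const m1 oa fd (v := v).
have jump2 : a v k2 + 2 < a v.-1 k2.
  have := @feas_row_le _ _ _ _ v k k2 fa; lia.
(* All rows below [v] lose one element together, so the differences of 2 among them survive; only
   the drop to row [v] shrinks, and there it has slack. *)
pose c i := a i k2 - (i < v).
have f2 : feas m s u (upd a k2 c).
  rewrite /c; apply: (feas_upd _ fa) => //; rewrite -?vu.
  - by move=> i j iv jm _; apply: live.
  - by move=> i iv; rewrite (cst i k2 iv c2); lia.
  - case: (k2 =P 0) => [e|ne]; last by rewrite pre //; lia.
    by rewrite ltnn subn0; apply: pre.
  - by move=> i ui; rewrite (feas_zero fa) //; lia.
  - move=> i k0; apply: leq_trans (leq_subr _ _) _.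
    by apply: (feas_row_le _ fa); lia.
  - move=> i km'; case: (ltnP i v) => iv; last by rewrite subn0; apply: (feas_row fa).
    by rewrite (cst i k2) // (cst i k2.+1) //; have := l2 km'; lia.
  - move=> i; case: (ltnP i.+1 v) => iv.
      have iv' : i < v by lia.
      rewrite iv' => p; have := feas_col fa (i := i) c2; lia.
    rewrite subn0 => p; have := feas_col fa c2 p.
    case: (i.+1 =P v) => [e|ne].
      by have := jump2; rewrite -e /=; lia.
    have -> : (i < v) = false by lia.
    by rewrite subn0.
  - move=> _; have -> : (k2 == m.-1) = false by lia.
    have h := feas_six fa; rewrite -vu in h; have := h v0.
    by case: eqP => [->|]; lia.
  - by move=> i p; have := feas_cap fa (i := i) c2; lia.
pose rho i : int := (if (i < v)%N then - 2 * ((k2 * s + s)%N%:Z - 1) + (- 2 * ((m * s)%N%:Z - 1)) * i%:Z else 0)%R.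
have := @opt_upd _ _ _ _ _ _ c rho (- v%:Z) oa c2 f2.
have -> : (\sum_(i < s) rho i = \sum_(i < v) (- 2 * ((k2 * s + s)%N%:Z - 1) + (- 2 * ((m * s)%N%:Z - 1)) * i%:Z))%R.
  rewrite (@big_below _ _ _ s v rho); first by apply: eq_bigr => i _; rewrite /rho ltn_ord.
    lia.
  by move=> i vi; rewrite /rho ltnNge vi.
move=> h.

have h1 : forall i, i < s -> (rho i <= roww m s i (upd a k2 c i) - roww m s i (a i))%R.
  move=> i _; have := roww_upd_lower (i := i) fa f2 c2.
  have hc : c i <= a i k2 <= (c i).+1 by rewrite /c; lia.
  move=> /(_ hc); apply: le_trans; rewrite /rho.
  case: (ltnP i v) => iv; last by rewrite /c ltnNge iv subn0 subrr mulr0 mul0r.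
  have -> : ((c i)%:Z - (a i k2)%:Z = -1)%R.
    by rewrite /c iv; have := live i k2 iv c2; lia.
  nia.
have h2 : (\sum_(i < s) ((c i)%:Z - (a i k2)%:Z) = - v%:Z)%R.
  rewrite (@big_below _ _ _ s v (fun i => (c i)%:Z - (a i k2)%:Z)%R); last 2 first.
  - lia.
  - by move=> i vi; rewrite /c ltnNge vi subn0 subrr.
  rewrite (eq_bigr (fun=> (-1)%R)); last first.
    by move=> i _; rewrite /c ltn_ord; have := live i k2 (ltn_ord i) c2; lia.
  by rewrite sumr_const card_ord; lia.
have := h h1 h2.
have := sum_affine v (- 2 * ((k2 * s + s)%N%:Z - 1)) (- 2 * ((m * s)%N%:Z - 1)).
set S := (\sum_(i < v) _)%R => eS leS.
(* All terms without the factor s cancel, and [v] can be divided out. *)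
have {eS leS h} key : (v%:Z * (2 * (cnt m s a)%:Z) <= v%:Z * (v.-1 * m * s + 2 * (k2.+1) * s)%N%:Z)%R by nia.
have : 2 * (k2.+1) * s <= 2 * K * s by rewrite leq_mul2r leq_mul2l; lia.
nia.
Qed.

(* Column K becomes 2 (v - i) + 1; g and g' count the blocks whose maximum drops
   because they get the size of the last block of their row. *)
Lemma fd_raise (m s u v K e : nat) (a : nat -> nat -> nat) (g g' : nat) (d : int) :
  1 < m -> opt m s u a -> first_dead m s u a v K -> a v.-1 K = e -> d = (3%:Z - e%:Z)%R ->
  (g = if K == m.-1 then \sum_(k < K) (a v.-1 k == 3) else 0) ->
  (g' = if K == m.-1 then \sum_(k < K) (a v k == 1) else 0) ->
  (v%:Z * (2 * d * (K * s + 1)%N%:Z - 2 * (2 * v%:Z + 1) * g%:Z)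
     + (d * (m * s + 1)%N%:Z + 2 * g%:Z) * v%:Z * (v%:Z - 1)
     + 2 * ((v * m + K) * s + 1 + v)%N%:Z - 2 * g'%:Z
   <= (d * v%:Z + 1) * (2 * (cnt m s a)%:Z + d * v%:Z))%R.
Proof.
move=> m1 oa fd eE dE gE g'E; have [fa _] := oa.
have [v0 bl] := fd_blocked m1 oa fd.
have [Km live pre dead top cap] := fd.
have uv : u <= v by rewrite top; case: eqP; lia.
have cst := fd_const m1 oa fd (v := v).
have e0 : 0 < e by rewrite -eE; apply: live => //; lia.
have e2 : e <= 2 by rewrite -eE.
(* The smallest column that reaches size 1 in row [v] and drops by 2 per row. In each lower row it
   exceeds the old column by 3 - e. *)
pose c i := if i <= v then 2 * (v - i) + 1 else 0.
have aK i : i < v -> a i K = e + 2 * (v.-1 - i) by move=> iv; rewrite (cst i K) // eE.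
have ca i : a i K <= c i.
  rewrite /c; case: (ltngtP i v) => iv.
  - by rewrite aK //; lia.
  - by rewrite (feas_zero fa) //; lia.
  - by rewrite iv dead.
have f1 : feas m s v (upd a K c).
  apply: (feas_upd _ fa) => //.
  - by move=> i k iv km _; apply: live.
  - by move=> i iv; rewrite /c (ltnW iv) addn1.
  - by case: (K =P 0) => [_|ne]; [rewrite /c leqnn addn1 | apply: pre; lia].
  - by move=> i vi; rewrite /c leqNgt vi.
  - move=> i K0; rewrite /c; case: (ltngtP i v) => // iv.
      rewrite (cst i K.-1) //; last lia.
      have KK : K.-1 < m by lia.
      have := feas_col fa (i := v.-1) KK; rewrite prednK //.
      by have := pre K.-1; lia.
    by rewrite iv subnn; apply: pre; lia.
  - by move=> i Km'; apply: leq_trans (feas_row fa i Km') _.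
  - by move=> i; rewrite /c; case: (leqP i.+1 v) => // iv _; rewrite (ltnW iv); lia.
  - move=> _; case: (K =P 0) => [K0|K0].
      have -> : (K == m.-1) = false by lia.
      by rewrite /c leqnn subnn; apply: live; lia.
    have vu : v = u by rewrite top; case: eqP.
    have := feas_six fa; rewrite -vu => /(_ v0).
    by have := ca v.-1; case: (K =P m.-1) => [->|]; lia.
  - by move=> i; rewrite /c; case: (leqP i v) => //; lia.
pose A : int := (2 * d * (K * s + 1)%N%:Z - 2 * (2 * v%:Z + 1) * g%:Z)%R.
pose B : int := (2 * d * (m * s + 1)%N%:Z + 4 * g%:Z)%R.
pose C : int := (2 * ((v * m + K) * s + 1 + v)%N%:Z - 2 * g'%:Z)%R.
pose rho i : int := (if (i < v)%N then A + B * i%:Z else if i == v then C else 0)%R.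
have h1 i : i < s -> (rho i <= roww m s i (upd a K c i) - roww m s i (a i))%R.
  move=> _.
  case: (ltnP K.+1 m) => Km'.
    have KE : (K == m.-1) = false by lia.
    have := roww_upd_raise (i := i) fa f1 Km' (ca i); apply: le_trans.
    rewrite /rho /A /B /C gE g'E KE dE.
    apply: le_trans (_ : (2 * ((c i)%:Z - (a i K)%:Z) * ((i * m + K) * s + 1 + i)%N%:Z <= _)%R); last first.
      by rewrite lerDl; lia.
    case: (ltngtP i v) => iv.
    - rewrite (aK _ iv) /c (ltnW iv).
      have -> : ((2 * (v - i) + 1)%N%:Z - (e + 2 * (v.-1 - i))%N%:Z = 3%:Z - e%:Z :> int)%R by lia.
      by nia.
    - have ui : u < i by lia.
      by rewrite (feas_zero fa ui Km) /c leqNgt iv; lia.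
    - by rewrite iv dead // /c leqnn subnn; lia.
  have KE : K = m.-1 by lia.
  have m0 : 0 < m by lia.
  have f1' := f1; rewrite KE in f1'.
  have ca' := ca i; rewrite KE in ca'.
  have := roww_upd_raise_last (i := i) m0 fa f1' ca'; rewrite -KE; apply: le_trans.
  rewrite /rho /A /B /C gE g'E KE eqxx -KE dE.
  case: (ltngtP i v) => iv.
  - have cE : c i = 2 * (v - i) + 1 by rewrite /c (ltnW iv).
    have -> : \sum_(k < K) (a i k == c i) = \sum_(k < K) (a v.-1 k == 3).
      apply: eq_bigr => k _; rewrite (cst i k) //; last by have := ltn_ord k; lia.
      by rewrite cE; congr nat_of_bool; lia.
    have -> : (c i != a i K) = true by rewrite cE (aK _ iv); lia.
    rewrite cE (aK _ iv).
    have -> : ((2 * (v - i) + 1)%N%:Z - (e + 2 * (v.-1 - i))%N%:Z = 3%:Z - e%:Z :> int)%R by lia.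
    have -> : ((2 * (v - i) + 1)%N%:Z = 2 * v%:Z - 2 * i%:Z + 1 :> int)%R by lia.
    by nia.
  - have ui : u < i by lia.
    by rewrite (feas_zero fa ui Km) /c leqNgt iv /=; move: (\sum_(k < K) _) => w; lia.
  - have cE : c v = 1 by rewrite /c leqnn subnn.
    by rewrite iv dead // cE; move: (\sum_(k < K) _) => w; lia.
have vs : v < s by lia.
have h2 : (\sum_(i < s) ((c i)%:Z - (a i K)%:Z) = d * v%:Z + 1)%R.
  rewrite (@big_below _ _ _ s v.+1 (fun i => (c i)%:Z - (a i K)%:Z)%R) //; last first.
    move=> i vi; rewrite (feas_zero fa) //; last lia.
    by rewrite /c leqNgt vi.
  rewrite big_ord_recr /= (eq_bigr (fun=> d)); last first.
    move=> i _; have iv := ltn_ord i; rewrite (aK _ iv) /c (ltnW iv) dE; lia.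
  by rewrite sumr_const card_ord dead // /c leqnn subnn -mulr_natr natz; lia.
have := opt_upd oa Km f1 h1 h2.
have -> : (\sum_(i < s) rho i = \sum_(i < v) (A + B * i%:Z) + C)%R.
  rewrite (@big_below _ _ _ s v.+1 rho) //; last first.
    by move=> i vi; rewrite /rho ltnNge (ltnW vi) /= gtn_eqF.
  rewrite big_ord_recr /= /rho ltnn eqxx; congr (_ + _)%R.
  by apply: eq_bigr => i _; rewrite ltn_ord.
have := sum_affine v A B; move: (\sum_(i < v) _)%R => S eS hS.
have key : (v%:Z * A + (d * (m * s + 1)%N%:Z + 2 * g%:Z) * v%:Z * (v%:Z - 1) = S)%R.
  by move: eS; rewrite /B; lia.
by rewrite -/A key; move: hS; rewrite /C; lia.
Qed.

(** This is [fd_raise] with e = 1, that is d = 2, against the bound of [fd_lower]. The losses [g],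
    [g'] occur only in the last column, where the stronger capacity 2 v + 3 <= s outweighs them. *)
Lemma fd_arith_slack1 (m s v K n g g' : nat) : 1 < m -> 0 < v -> K < m -> g <= K -> g' <= K ->
  2 * v + 2 + (K == m.-1) <= s ->
  2 * n <= v.-1 * m * s + 2 * K * s ->
  (K != m.-1 -> g = 0 /\ g' = 0) ->
  ~ (2 * m * s * v * v + 2 * (2 * v + 1) * K * s + 2 * (v+1) * (v+1)
     <= (2 * v + 1) * (2 * n + 2 * v) + 2 * g * (v * v + 2 * v) + 2 * g').
Proof.
case: m => // M; case: v => // v; rewrite /= => m1 _ Km gK g'K hs hn hg h.
have h1 : (2 * v.+1 + 1) * (2 * n) <= (2 * v.+1 + 1) * (v * M.+1 * s + 2 * K * s).
  by rewrite leq_mul2l hn orbT.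
have hp x : x <= s -> v.+2 * M.+1 * x <= v.+2 * M.+1 * s.
  by move=> xs; rewrite leq_mul2l xs orbT.
have p1 := leq0n (M * v); have p2 := leq0n (v * v); have p3 := leq0n (M * (v * v)).
case: (K =P M) hs hg => [KE|KE] hs hg.
  have : 2 * g * (v.+1 * v.+1 + 2 * v.+1) <= 2 * M * (v.+1 * v.+1 + 2 * v.+1).
    by rewrite leq_mul2r leq_mul2l; lia.
  subst K; have := hp (2 * v.+1 + 3); lia.
have [gg gg'] : g = 0 /\ g' = 0 by exact: hg.
have := hp (2 * v.+1 + 2).
have : v * 1 <= v * M by rewrite leq_mul2l; lia.
have : v * v * 1 <= v * v * M by rewrite leq_mul2l; lia.
subst g g'; lia.
Qed.

(** The case e = 2, that is d = 1. The terms in [K * s] cancel; there remains (v + 1) (m s + 2)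
    against a loss of at most 2 (m - 1) (v + 1)^2, again with 2 v + 3 <= s. *)
Lemma fd_arith_slack2 (m s v K n g g' : nat) : 1 < m -> 0 < v -> K < m -> g <= K -> g' <= K ->
  2 * v + 2 + (K == m.-1) <= s ->
  2 * n <= v.-1 * m * s + 2 * K * s ->
  (K != m.-1 -> g = 0 /\ g' = 0) ->
  ~ (v.+1 * (m * s * v + 2 * K * s + 2)
     <= v.+1 * (2 * n) + 2 * g * (v * v + 2 * v) + 2 * g').
Proof.
case: m => // M; case: v => // v; rewrite /= => m1 _ Km gK g'K hs hn hg h.
have h1 : v.+2 * (2 * n) <= v.+2 * (v * M.+1 * s + 2 * K * s).
  by rewrite leq_mul2l hn orbT.
have hp x : x <= s -> v.+2 * M.+1 * x <= v.+2 * M.+1 * s.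
  by move=> xs; rewrite leq_mul2l xs orbT.
have p1 := leq0n (M * v); have p2 := leq0n (v * v); have p3 := leq0n (M * (v * v)).
case: (K =P M) hs hg => [KE|KE] hs hg.
  have : 2 * g * (v.+1 * v.+1 + 2 * v.+1) <= 2 * M * (v.+1 * v.+1 + 2 * v.+1).
    by rewrite leq_mul2r leq_mul2l; lia.
  subst K; have := hp (2 * v.+1 + 3); lia.
have [gg gg'] : g = 0 /\ g' = 0 by exact: hg.
have := hp 0; subst g g'; lia.
Qed.

(** The case e = 1 without slack, where n is bounded by summing the columns. The terms with the
    factor s dominate by the capacity. *)
Lemma fd_arith_tight1 (m s v K n g g' : nat) : 1 < m -> 0 < v -> K < m -> g <= K -> g' <= K ->
  2 * v + 2 + (K == m.-1) <= s ->
  n <= m * v * v + K * (2 * v + 1) ->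
  (K != m.-1 -> g = 0 /\ g' = 0) ->
  ~ (2 * m * s * v * v + 2 * (2 * v + 1) * K * s + 2 * (v+1) * (v+1)
     <= (2 * v + 1) * (2 * n + 2 * v) + 2 * g * (v * v + 2 * v) + 2 * g').
Proof.
case: m => // M; rewrite /= => m1 v0 Km gK g'K hs hn hg h.
have h1 : (2 * v + 1) * (2 * n) <= (2 * v + 1) * (2 * (M.+1 * v * v + K * (2 * v + 1))).
  by rewrite leq_mul2l leq_mul2l hn !orbT.
have hp x : x <= s -> (2 * M.+1 * v * v + 2 * (2 * v + 1) * K) * x
    <= (2 * M.+1 * v * v + 2 * (2 * v + 1) * K) * s.
  by move=> xs; rewrite leq_mul2l xs orbT.
have p1 := leq0n (M * v); have p2 := leq0n (v * v); have p3 := leq0n (M * (v * v)).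
have p4 : v * v * 1 <= v * v * M by rewrite leq_mul2l; lia.
have p5 := leq0n (K * v).
case: (K =P M) hs hg => [KE|KE] hs hg.
  have : 2 * g * (v * v + 2 * v) <= 2 * M * (v * v + 2 * v).
    by rewrite leq_mul2r leq_mul2l; lia.
  subst K; have := hp (2 * v + 3); lia.
have [gg gg'] : g = 0 /\ g' = 0 by exact: hg.
have := hp (2 * v + 2); subst g g'; lia.
Qed.

(** The case e = 2 without slack. The total loss 2 g (v^2 + 2 v) + 2 g = 2 g (v + 1)^2 is matched
    exactly by the correction [v.+1 * g] in the bound on n, so no distinction on the column is
    necessary. *)
Lemma fd_arith_tight2 (m s v K n g : nat) :
  2 * v + 2 <= s ->
  n + v.+1 * g <= m * v * v.+1 + K * (2 * v + 2) ->
  ~ (v.+1 * (m * s * v + 2 * K * s + 2)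
     <= v.+1 * (2 * n) + 2 * g * (v * v + 2 * v) + 2 * g).
Proof.
move=> hs hn h.
have h1 : v.+1 * (2 * (n + v.+1 * g)) <= v.+1 * (2 * (m * v * v.+1 + K * (2 * v + 2))).
  by rewrite !leq_mul2l hn !orbT.
have : v.+1 * (m * v + 2 * K) * (2 * v + 2) <= v.+1 * (m * v + 2 * K) * s by rewrite leq_mul2l hs orbT.
lia.
Qed.

Lemma no_first_dead (m s u v K : nat) (a : nat -> nat -> nat) :
  1 < m -> opt m s u a -> first_dead m s u a v K -> False.
Proof.
move=> m1 oa fd; have [fa _] := oa.
have [v0 bl] := fd_blocked m1 oa fd.
have [Km live pre dead top cap] := fd.
have epos : 0 < a v.-1 K by apply: live => //; lia.
pose g0 := \sum_(k < K) (a v.-1 k == 3).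
pose g1 := \sum_(k < K) (a v k == 1).
have sumb (F : nat -> bool) : \sum_(k < K) F k <= K.
  rewrite -[X in _ <= X]muln1 -[X in _ <= X * _]card_ord -sum_nat_const leq_sum // => k _.
  by case: (F k).
have g0K : g0 <= K by exact: (sumb (fun k => a v.-1 k == 3)).
have g1K : g1 <= K by exact: (sumb (fun k => a v k == 1)).
have := fd_raise m1 oa fd (erefl _) (erefl _) (erefl _) (erefl _).
rewrite -/g0 -/g1.
set G := (if K == m.-1 then g0 else 0); set G' := (if K == m.-1 then g1 else 0).
have GK : G <= K by rewrite /G; case: eqP.
have G'K : G' <= K by rewrite /G'; case: eqP.
have hG : K != m.-1 -> G = 0 /\ G' = 0 by rewrite /G /G' => /negbTE ->.
have gap k : k < K -> a v k + 2 <= a v.-1 k.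
  move=> kK; have km : k < m by lia.
  by have := feas_col fa (i := v.-1) km; rewrite prednK //; have := pre k kK; lia.
have [|nojump] := boolP [exists k : 'I_K, a v k + 2 < a v.-1 k].
  case/existsP => k jump; have := fd_lower m1 oa fd (ltn_ord k) jump.
  move: (cnt m s a) => n.
  have [->|->] : a v.-1 K = 1 \/ a v.-1 K = 2 by lia.
    move=> hn hr; apply: (fd_arith_slack1 m1 v0 Km GK G'K cap hn hG).
    by clear -hr; lia.
  move=> hn hr; apply: (fd_arith_slack2 m1 v0 Km GK G'K cap hn hG).
  by clear -hr; lia.
have eqk k : k < K -> a v.-1 k = a v k + 2.
  move=> kK; have := gap k kK; move/existsPn: nojump => /(_ (Ordinal kK)) /=; lia.
have g01 : g1 = g0.
  by apply: eq_bigr => k _; rewrite eqk //; congr nat_of_bool; lia.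
(* Condition (6) carries the bound from the first block of row [v] to the last block of row [v.-1],
   and monotonicity of that row to column [K]. *)
have gle k : k < K -> 1 <= a v k <= a v.-1 K.
  move=> kK; rewrite pre //=.
  have vu : v = u by rewrite top; case: eqP; lia.
  have := feas_six fa; rewrite -vu => /(_ v0).
  have := @feas_row_le _ _ _ _ v 0 k fa; have := @feas_row_le _ _ _ _ v.-1 K m.-1 fa; lia.
have rle k : K <= k -> k < m -> a v.-1 k <= a v.-1 K by move=> *; apply: (feas_row_le _ fa).
rewrite (fd_cnt m1 oa fd).
have [eE|eE] : a v.-1 K = 1 \/ a v.-1 K = 2 by lia.
  have := @sum_two_parts m K (3 * v + 1) v (fun k => v * a v.-1 k + a v k) (fun=> 0) (ltnW Km).
  rewrite big1_eq addn0 => hn.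
  have {hn} : \sum_(k < m) (v * a v.-1 k + a v k) <= K * (3 * v + 1) + (m - K) * v.
    apply: hn => [k kK|k Kk km].
      by have := gle k kK; rewrite (eqk k kK) eE; nia.
    by rewrite dead //; have := rle k Kk km; have := live v.-1 k; nia.
  move: (\sum_(k < m) _) => n hn; rewrite eE => hr.
  have hn' : n + m * v * v.-1 <= m * v * v + K * (2 * v + 1).
    have Kv : K * v <= m * v by rewrite leq_mul2r; lia.
    by move: hn; rewrite mulnBl; clear -Kv v0; case: v v0 Kv => //= v _; lia.
  apply: (fd_arith_tight1 m1 v0 Km GK G'K cap hn' hG).
  by clear -hr; lia.
(* Sizes 4 and 2 in rows v - 1 and v contribute 4 v + 2, sizes 3 and 1 only 3 v + 1. The deficit v +
   1 is the weight of each block counted by [g0]. *)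
have := @sum_two_parts m K (4 * v + 2) (2 * v) (fun k => v * a v.-1 k + a v k)
  (fun k => v.+1 * (a v.-1 k == 3)) (ltnW Km).
rewrite -big_distrr /= -/g0 => hn.
have {hn} : \sum_(k < m) (v * a v.-1 k + a v k) + v.+1 * g0 <= K * (4 * v + 2) + (m - K) * (2 * v).
  apply: hn => [k kK|k Kk km].
    have := gle k kK; rewrite (eqk k kK) eE => h.
    have [->|->] : a v k = 1 \/ a v k = 2 by lia.
      by rewrite /=; lia.
    by rewrite /=; lia.
  by rewrite dead //; have := rle k Kk km; nia.
move: (\sum_(k < m) _) => n hn; rewrite eE => hr.
have G01 : G' = G by rewrite /G /G' g01.
have hn' : n + m * v * v.-1 + v.+1 * G <= m * v * v.+1 + K * (2 * v + 2).
  have Kv : K * v <= m * v by rewrite leq_mul2r; lia.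
  have Gg : v.+1 * G <= v.+1 * g0.
    by apply: leq_mul => //; rewrite /G; case: (K =P m.-1).
  move: Gg hn; rewrite mulnBl [m * (2 * v)]mulnCA [K * (2 * v)]mulnCA.
  by move: (G) (g0) => x y; clear -Kv v0; case: v v0 Kv => //= v _; lia.
have hs' : 2 * v + 2 <= s by lia.
apply: (fd_arith_tight2 hs' hn').
by move: hr; rewrite G01; clear; lia.
Qed.

(** * The top row *)

(* In the top row 2, ..., 2, 1, ..., 1, the two columns next to the step compete:
   raising the right one and lowering the left one by one element per row
   cannot both lose. *)
Lemma opt_no_step (m s u p : nat) (a : nat -> nat -> nat) :
  opt m s u a -> s = 2 * u + 3 -> p.+2 < m -> (forall k, k < m -> 0 < a u k) ->
  a u p = 2 -> a u p.+1 = 1 -> False.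
Proof.
move=> oa sE pm live ap ap1; have [fa _] := oa.
have m1 : 1 < m by lia.
have us := feas_live_bound m1 fa.
have zero i k : u < i -> k < m -> a i k = 0 by exact: (feas_zero fa).
have pos i k : i < u -> k < m -> 0 < a i k by exact: (feas_pos fa).
have au2 k : k < m -> a u k <= 2 by move=> km; have := feas_cap fa (i := u) km; lia.
have al : a u m.-1 = 1.
  have lm : m.-1 < m by lia.
  have := live m.-1 lm; have := feas_cap fa (i := u) lm; rewrite eqxx; lia.
have cst i k : i <= u -> k < m -> a i k = a u k + 2 * (u - i).
  move=> iu km.
  have step j : j < u -> a j k = a j.+1 k + 2.
    move=> ju; apply: (opt_no_jump m1 oa) => //.
      by case: (ltngtP j.+1 u) ju => // [h|->] _; [apply: pos | apply: live].
    case: (ltnP j.+1 u) => ju'; [by left | right].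
    have e : u = j.+1 by lia.
    have lm : m.-1 < m by lia.
    have := feas_col fa (i := j) lm; rewrite -e al; have := au2 0; lia.
  have key d : forall j, j + d = u -> a j k = a u k + 2 * d.
    elim: d => [|d IH] j e; first by rewrite -e !addn0.
    by rewrite step; [rewrite (IH j.+1); lia | lia].
  by apply: key; lia.
(* Changing all rows up to [u] at once preserves the differences of 2. *)
pose cA i := a i p.+1 + (i <= u).
pose cB i := a i p - (i <= u).
have fA : feas m s u (upd a p.+1 cA).
  rewrite /cA; apply: (feas_upd _ fa) => //=.
  - lia.
  - by move=> i k iu km _; apply: pos.
  - by move=> i iu; have := pos i p.+1 iu; lia.
  - exact: (feas_pos0 fa).
  - by move=> i ui; rewrite zero //; lia.
  - move=> i _; case: (leqP i u) => iu; last by rewrite zero //; lia.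
    by rewrite (cst i p.+1) // ?(cst i p) //; lia.
  - by move=> i pm'; have := feas_row fa i pm'; lia.
  - move=> i; case: (leqP i.+1 u) => iu; last by rewrite zero //; lia.
    by rewrite (cst i.+1 p.+1) // ?(cst i p.+1); lia.
  - have -> : (p.+1 == m.-1) = false by lia.
    by move=> u0; apply: (feas_six fa).
  - have -> : (p.+1 == m.-1) = false by lia.
    move=> i; case: (leqP i u) => iu; last by rewrite zero //; lia.
    by rewrite (cst i p.+1) //; lia.
have fB : feas m s u (upd a p cB).
  rewrite /cB; apply: (feas_upd _ fa) => //=.
  - lia.
  - by move=> i k iu km _; apply: pos.
  - by move=> i iu; rewrite (cst i p) ?(ltnW iu) //; lia.
  - by case: (p =P 0) => [_|_]; [rewrite ap; lia | apply: (feas_pos0 fa)].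
  - by move=> i ui; rewrite zero //; lia.
  - move=> i p0; apply: leq_trans (leq_subr _ _) _.
    by apply: (feas_row_le _ fa); lia.
  - move=> i _; case: (leqP i u) => iu; last by rewrite zero //; lia.
    by rewrite (cst i p.+1) // ?(cst i p) //; lia.
  - move=> i; case: (leqP i.+1 u) => iu; last by rewrite zero //; lia.
    by rewrite (cst i.+1 p) // ?(cst i p); lia.
  - have -> : (p == m.-1) = false by lia.
    move=> u0; have := feas_six fa u0; case: (p =P 0) => [->|//]; lia.
  - by move=> i q; have := feas_cap fa (i := i) (k := p); lia.
have pm1 : p.+1 < m by lia.
have pm0 : p < m by lia.
have su : u.+1 <= s by lia.
pose rA i : int := (if (i <= u)%N then 2 * ((p.+1 * s + s)%N%:Z - 1) + 2 * ((m * s)%N%:Z - 1) * i%:Z else 0)%R.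
pose rB i : int := (if (i <= u)%N then - 2 * ((p * s + s)%N%:Z - 1) + (- 2 * ((m * s)%N%:Z - 1)) * i%:Z else 0)%R.
have hA := @opt_upd _ _ _ _ _ _ cA rA u.+1%:Z oa pm1 fA.
have hB := @opt_upd _ _ _ _ _ _ cB rB (- u.+1%:Z)%R oa pm0 fB.
have {}hA : (\sum_(i < u.+1) (2 * ((p.+1 * s + s)%N%:Z - 1) + 2 * ((m * s)%N%:Z - 1) * i%:Z)
    <= u.+1%:Z * (2 * (cnt m s a)%:Z + u.+1%:Z - 1))%R.
  rewrite (@big_below _ _ _ s u.+1 rA) // in hA; last first.
    by move=> i ui; rewrite /rA leqNgt ui.
  rewrite (eq_bigr (fun i : 'I_u.+1 => rA i)); last first.
    by move=> i _; rewrite /rA -ltnS ltn_ord.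
  apply: hA.
    move=> i _; have := roww_upd_raise (i := i) fa fA pm (leq_addr _ _); apply: le_trans.
    rewrite -/cA -/(cA i) /rA /cA; case: (leqP i u) => iu; last by rewrite zero //; lia.
    (* The block leaves the size of the last block, so its maximum rises as well: the net gain is a
       whole element of residue s - 1 - i, the largest possible. *)
    rewrite (cst i p.+1) // (cst i m.-1) // ?ap1 ?al; last lia.
    have -> : (1 + 2 * (u - i) + true != 1 + 2 * (u - i)) = true by lia.
    rewrite eqxx /=.
    have -> : ((1 + 2 * (u - i))%N%:Z = s%:Z - 2 - 2 * i%:Z :> int)%R by lia.
    have -> : ((1 + 2 * (u - i) + 1)%N%:Z = s%:Z - 1 - 2 * i%:Z :> int)%R by lia.
    by lia.
  rewrite (@big_below _ _ _ s u.+1 (fun i => (cA i)%:Z - (a i p.+1)%:Z)%R) //; last first.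
    by move=> i ui; rewrite /cA leqNgt ui addn0 subrr.
  rewrite (eq_bigr (fun=> 1%R)); last by move=> i _; rewrite /cA -ltnS ltn_ord; lia.
  by rewrite sumr_const card_ord natz.
have {}hB : (\sum_(i < u.+1) (- 2 * ((p * s + s)%N%:Z - 1) + (- 2 * ((m * s)%N%:Z - 1)) * i%:Z)
    <= - u.+1%:Z * (2 * (cnt m s a)%:Z - u.+1%:Z - 1))%R.
  rewrite (@big_below _ _ _ s u.+1 rB) // in hB; last first.
    by move=> i ui; rewrite /rB leqNgt ui.
  rewrite (eq_bigr (fun i : 'I_u.+1 => rB i)); last first.
    by move=> i _; rewrite /rB -ltnS ltn_ord.
  apply: hB.
    move=> i _; have hc : cB i <= a i p <= (cB i).+1 by rewrite /cB; case: (i <= u); lia.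
    have := roww_upd_lower (i := i) fa fB pm0 hc; apply: le_trans.
    rewrite /rB /cB; case: (leqP i u) => iu; last by rewrite zero //; lia.
    have -> : ((a i p - true)%N%:Z - (a i p)%:Z = -1 :> int)%R.
      by rewrite (cst i p) // ap; lia.
    by lia.
  rewrite (@big_below _ _ _ s u.+1 (fun i => (cB i)%:Z - (a i p)%:Z)%R) //; last first.
    by move=> i ui; rewrite /cB leqNgt ui subn0 subrr.
  rewrite (eq_bigr (fun=> (-1)%R)); last first.
    by move=> i _; have iu := ltn_ord i; rewrite /cB -ltnS iu (cst i p) // ap; lia.
  by rewrite sumr_const card_ord; lia.
have := sum_affine u.+1 (2 * ((p.+1 * s + s)%N%:Z - 1)) (2 * ((m * s)%N%:Z - 1)).
have := sum_affine u.+1 (- 2 * ((p * s + s)%N%:Z - 1)) (- 2 * ((m * s)%N%:Z - 1)).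
move: hA hB; move: (\sum_(i < u.+1) _)%R (\sum_(i < u.+1) _)%R => X Y hX hY eY eX.
(* Adding both estimates eliminates n and leaves s <= u + 1, against s = 2 u + 3. *)
have : u.+1 * s <= u.+1 * u.+1 by lia.
rewrite leq_mul2l; lia.
Qed.

(** The first empty block must have capacity 0. If the last block of the top row is empty, this
    forces the first empty one to be in the last column and s = 2 u + 2. If the row is full, it
    forces s < 2 u + 4 through the first block of row u + 1. *)
Lemma opt_top_row (m s u : nat) (a : nat -> nat -> nat) :
  1 < m -> opt m s u a ->
  (s = 2 * u + 3 /\
    ((forall k, k < m -> a u k = 1) \/
     ((forall k, k.+1 < m -> a u k = 2) /\ a u m.-1 = 1))) \/
  (s = 2 * u + 2 /\ (forall k, k.+1 < m -> a u k = 1)).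
Proof.
move=> m1 oa; have [fa _] := oa.
have us := feas_live_bound m1 fa.
have lm : m.-1 < m by lia.
have [am|am] := posnP (a u m.-1).
  have ex0 : exists k, a u k == 0 by exists m.-1; rewrite am.
  pose K := ex_minn ex0.
  have [aK Kmin] : a u K = 0 /\ forall k, k < K -> 0 < a u k.
    rewrite /K; case: ex_minnP => k /eqP ak kmin; split=> // j jk.
    by rewrite lt0n; apply/negP => /kmin; lia.
  have Km : K < m by rewrite ltnNge; apply/negP => mK; have := Kmin m.-1; lia.
  have K0 : 0 < K by rewrite lt0n; apply/eqP => K0; have := feas_pos0 fa; rewrite K0 in aK; lia.
  right.
  case: (leqP (2 * u + 2 + (K == m.-1)) s) => cap.
    exfalso; apply: (@no_first_dead m s u u K a m1 oa); split=> //.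
    - exact: (feas_pos fa).
    - by move=> k Kk km; have := @feas_row_le _ _ _ _ u K k fa Kk km; lia.
    - by case: eqP; lia.
  have KE : K = m.-1 by move: cap; case: eqP; lia.
  move: cap; rewrite KE eqxx => cap; split; first lia.
  move=> k km; have kK : k < K by lia.
  by have := Kmin k kK; have := feas_cap fa (i := u) (k := k); lia.
have live k : k < m -> 0 < a u k.
  by move=> km; have := @feas_row_le _ _ _ _ u k m.-1 fa; lia.
have cm := feas_cap fa lm am; rewrite eqxx in cm.
have sE : s = 2 * u + 3.
  case: (ltnP (2 * u + 3) s) => // h; last lia.
  exfalso; apply: (@no_first_dead m s u u.+1 0 a m1 oa); split=> //.
  - lia.
  - move=> i k iu km; case: (ltngtP i u) => h'; [exact: (feas_pos fa) | lia | by rewrite h'; apply: live].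
  - by move=> k _ km; rewrite (feas_zero fa).
  - lia.
left; split=> //.
have am1 : a u m.-1 = 1 by lia.
have au2 k : k < m -> 1 <= a u k <= 2.
  by move=> km; rewrite live //; have := feas_cap fa (i := u) km; have := live k km; lia.
case: (a u 0 =P 1) => [a0|a0].
  left=> k km; have := @feas_row_le _ _ _ _ u 0 k fa; have := live k km; lia.
have all2 k : k.+1 < m -> a u k = 2.
  elim: k => [|k IH] km; first by have := au2 0; lia.
  have ak : a u k = 2 by apply: IH; lia.
  have km1 : k.+1 < m by lia.
  apply/eqP/negPn/negP => ne.
  apply: (@opt_no_step m s u k a oa) => //; have := au2 k.+1; lia.
by right.
Qed.

(** * From sets to arrays *)

Lemma inL_block (m s x : nat) :
  inL m s x <->
  exists i k r, [/\ k < m, x = (i * m + k) * s + r, i + 1 <= r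
                  & r + 1 + i + (k == m.-1) <= s].
Proof.
split.
  case=> k /andP[k1 km] [i [j [-> lo hi]]].
  exists i, k.-1, (j - k.-1 * s); split.
  - lia.
  - by rewrite mulnDl mulnA -addnA subnKC //; lia.
  - by lia.
  - have ks : k * s = k.-1 * s + s by case: (k) k1 => // k' _; rewrite mulSn addnC.
    by move: hi; have [kl|kl] := ltnP k m; case: eqP; lia.
case=> i [k [r [km -> lo hi]]].
exists k.+1; first by rewrite km.
exists i, (k * s + r); split; first by rewrite mulnDl mulnA addnA.
  by rewrite /=; lia.
by rewrite mulSn; case: ltnP => h; move: hi; case: eqP; lia.
Qed.

Lemma mem_block (s p x : nat) (S : {fset nat}) :
  0 < s -> (x \in block s S p.+1) = (x \in S) && (x %/ s == p).
Proof.
move=> s0; rewrite /block !inE /=; congr (_ && _).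
by rewrite [RHS]eqn_leq andbC leq_divRL // -[x %/ s <= p]ltnS ltn_divLR.
Qed.

Lemma block_nat_inj (m i k i' k' : nat) :
  k < m -> k' < m -> i * m + k = i' * m + k' -> i = i' /\ k = k'.
Proof.
move=> km km' e.
have m0 : 0 < m by lia.
have := congr1 (divn^~ m) e; rewrite /= !divnMDl // !divn_small // !addn0 => ->.
by have := congr1 (modn^~ m) e; rewrite /= !modnMDl !modn_small.
Qed.

Lemma inL_in_block (m s i k x : nat) (S : {fset nat}) :
  (forall x, x \in S -> inL m s x) -> k < m -> x \in block s S (i * m + k).+1 ->
  [/\ x = (i * m + k) * s + x %% s, i + 1 <= x %% s
    & x %% s + 1 + i + (k == m.-1) <= s].
Proof.
move=> SL km xb.
have /inL_block [i' [k' [r [km' xE lo hi]]]] : inL m s x.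
  by apply: SL; move: xb; rewrite !inE => /andP[].
have rs : r < s by lia.
have s0 : 0 < s by lia.
move: xb; rewrite mem_block // => /andP[_ /eqP xd].
have e : i * m + k = i' * m + k' by rewrite -xd xE divnMDl // divn_small // addn0.
have [-> ->] := block_nat_inj km km' e.
by rewrite xE modnMDl modn_small.
Qed.

Lemma block_index_split (m j : nat) :
  0 < m -> 0 < j -> exists i k, k < m /\ j = (i * m + k).+1.
Proof.
move=> m0 j0; exists (j.-1 %/ m), (j.-1 %% m); split; first by rewrite ltn_mod.
by rewrite -divn_eq prednK.
Qed.

Lemma dvdn_block_index (m i k : nat) : k < m -> (m %| (i * m + k).+1) = (k.+1 == m).
Proof.
move=> km; rewrite -addnS dvdn_addr ?dvdn_mull //.
apply/idP/eqP => [h|->]; last exact: dvdnn.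
by have := dvdn_leq (ltn0Sn k) h; lia.
Qed.

(** The extremal list is h, h - 1, and so on. The bound is written additively to avoid truncated
    subtraction; the induction removes the largest value if it occurs. *)
Lemma sum_uniq_le (h : nat) (l : seq nat) :
  uniq l -> (forall x, x \in l -> x <= h) ->
  2 * \sum_(x <- l) x + size l * (size l).-1 <= 2 * (size l * h).
Proof.
elim: h l => [|h IH] l ul hl.
  have : size l <= 1 by apply: (@uniq_leq_size _ l [:: 0]) => // x /hl; rewrite leqn0 inE.
  case: l ul hl => [|x [|y l]] //= ul hl _; first by rewrite big_nil.
  by rewrite big_seq1; have := hl x; rewrite inE eqxx; lia.
have [hin|hin] := boolP (h.+1 \in l); last first.
  have le x : x \in l -> x <= h.
    by move=> xl; have := hl x xl; case: (x =P h.+1) xl => [->|]; [rewrite (negbTE hin) | lia].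
  have := IH l ul le; rewrite mulnS; lia.
have ur : uniq (rem h.+1 l) by exact: rem_uniq.
have le x : x \in rem h.+1 l -> x <= h.
  by rewrite mem_rem_uniq // inE => /andP[/eqP ne /hl]; lia.
have := IH _ ur le; rewrite size_rem //.
rewrite (perm_big _ (perm_to_rem hin)) big_cons /=.
have : 0 < size l by case: (l) hin.
case: (size l) => // n _ /=; case: n => [|n] /=; lia.
Qed.

Lemma big_blocks (m s : nat) (S : {fset nat}) (F : nat -> nat) :
  0 < m -> 0 < s -> (forall x, x \in S -> x %/ s < s * m) ->
  \sum_(x <- S) F x = \sum_(i < s) \sum_(k < m) \sum_(x <- block s S (i * m + k).+1) F x.
Proof.
move=> m0 s0 hS.
have blkE p : \sum_(x <- block s S p.+1) F x = \sum_(x <- S) (if x %/ s == p then F x else 0).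
  rewrite -big_mkcond -[RHS]big_filter; apply: perm_big; apply: uniq_perm.
  - exact: fset_uniq.
  - by rewrite filter_uniq.
  - by move=> x; rewrite mem_filter andbC; apply: mem_block.
rewrite [RHS](eq_bigr (fun i : 'I_s =>
    \sum_(x <- S) \sum_(k < m) (if x %/ s == i * m + k then F x else 0))); last first.
  by move=> i _; rewrite exchange_big; apply: eq_bigr => k _; apply: blkE.
rewrite exchange_big /= !big_seq; apply: eq_bigr => x xS.
have ilt : x %/ s %/ m < s by rewrite ltn_divLR // hS.
have klt : x %/ s %% m < m by rewrite ltn_mod.
rewrite (bigD1 (Ordinal ilt)) //= (bigD1 (Ordinal klt)) //= -divn_eq eqxx.
rewrite !big1 ?addn0 //.
- move=> i ne; rewrite big1 // => k _; case: eqP => // e.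
  case/eqP: ne; apply/val_inj => /=.
  by rewrite e divnMDl // divn_small // addn0.
- move=> k ne; case: eqP => // e.
  case/eqP: ne; apply/val_inj => /=.
  by rewrite [in RHS]e modnMDl modn_small.
Qed.

Lemma fval_double (m s : nat) (S : {fset nat}) :
  0 < m -> 0 < s -> (forall x, x \in S -> x %/ s < s * m) ->
  let n := cnt m s (fun i k => blk_card s S (i * m + k).+1) in
  (2 * fval S = \sum_(i < s) \sum_(k < m)
      2 * (\sum_(x <- block s S (i * m + k).+1) x)%N%:Z - n%:Z * (n%:Z - 1))%R.
Proof.
move=> m0 s0 hS n.
have nE : n = #|` S|.
  rewrite -sum1_size (big_blocks (fun=> 1) m0 s0 hS) /n /cnt.
  by apply: eq_bigr => i _; apply: eq_bigr => k _; rewrite sum1_size.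
rewrite /fval -nE (big_blocks id m0 s0 hS) mulrBr.
have -> : (2 * (n * n.-1 %/ 2)%N%:Z = n%:Z * (n%:Z - 1))%R.
  have ev : 2 %| n * n.-1 by rewrite dvdn2; case: (n) => //= n'; rewrite oddM /=; case: (odd n').
  have h : (n * n.-1 %/ 2) * 2 = n * n.-1 by rewrite divnK.
  case: (n) h => [|n'] /=; lia.
congr (_ - _)%R.
rewrite (big_morph Posz PoszD (erefl _)) mulr_sumr; apply: eq_bigr => i _.
by rewrite (big_morph Posz PoszD (erefl _)) mulr_sumr.
Qed.

Definition blk_mx (m s : nat) (S : {fset nat}) (i k : nat) : nat :=
  blk_card s S (i * m + k).+1.

Lemma blk_mx_cap (m s i k : nat) (S : {fset nat}) :
  (forall x, x \in S -> inL m s x) -> k < m -> 0 < blk_mx m s S i k ->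
  blk_mx m s S i k + 2 * i + 1 + (k == m.-1) <= s.
Proof.
move=> SL km pos.
pose e := nat_of_bool (k == m.-1).
have : size (block s S (i * m + k).+1)
    <= size (iota ((i * m + k) * s + i.+1) (s - 1 - 2 * i - e)).
  apply: uniq_leq_size; first exact: fset_uniq.
  move=> x /(inL_in_block SL km) [xE lo hi]; rewrite mem_iota /e xE.
  move: (x %% s) lo hi => r lo hi; move: ((i * m + k) * s) => B.
  by apply/andP; split; lia.
rewrite size_iota -/(blk_card _ _ _) -/(blk_mx m s S i k) /e; lia.
Qed.

Lemma blk_max_le (m s i k : nat) (S : {fset nat}) :
  (forall x, x \in S -> inL m s x) -> k < m ->
  blk_max s S (i * m + k).+1 <= s - 1 - i - (k == m.-1).
Proof.
move=> SL km; rewrite /blk_max; apply/bigmax_leqP_seq => x xb _.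
have [_ lo hi] := inL_in_block SL km xb; lia.
Qed.

(** By minimality of t some element is at least (t - 1) m s, and condition (1) read backwards makes
    all blocks before its block nonempty. *)
Lemma gbs_live (m s : nat) (S : {fset nat}) :
  1 < m -> 2 < s -> gen_beta_set m s S ->
  forall p, p <= (tmin m s S).-1 * m -> 0 < blk_card s S p.+1.
Proof.
move=> m1 s2 gS; have SL := gbs_subL gS.
have m0 : 0 < m by lia.
have s0 : 0 < s by lia.
have [wt tm] := tmin_spec m0 s2 SL.
have [x xS xge] : exists2 x, x \in S & (tmin m s S).-1 * (m * s) <= x.
  have [t1|t1] := leqP (tmin m s S) 1.
    by have [x xS] := fset0Pn _ (gbs_neq0 gS); exists x => //; have -> : (tmin m s S).-1 = 0 by lia.
  have : ~~ within m s S (tmin m s S).-1.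
    by apply/negP => /tm; lia.
  rewrite /within negb_and => /orP[|/allPn[x xS]]; first lia.
  by rewrite -leqNgt => h; exists x.
pose p0 := x %/ s.
have bx : 0 < blk_card s S p0.+1.
  rewrite /blk_card cardfs_gt0; apply/fset0Pn; exists x.
  by rewrite mem_block // xS eqxx.
have p0N : p0 < bigN m s.
  have /andP[_ h] := inL_bound m0 (SL x xS).
  by rewrite ltn_divLR.
have ple : (tmin m s S).-1 * m <= p0 by rewrite leq_divRL // -mulnA.
have down d : forall p, p + d = p0 -> 0 < blk_card s S p.+1.
  elim: d => [|d IH] p e; first by have -> : p = p0 by lia.
  rewrite lt0n; apply/eqP => z.
  have := gbs1 gS (i := p.+1) _ z; rewrite (_ : 1 <= p.+1 < bigN m s) //; last lia.
  move=> /(_ isT) z'; have := IH p.+1; rewrite z'; lia.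
by move=> p ple'; apply: (down (p0 - p)); lia.
Qed.

Lemma gbs_feas (m s : nat) (S : {fset nat}) :
  1 < m -> 2 < s -> gen_beta_set m s S ->
  0 < tmin m s S /\ feas m s (tmin m s S).-1 (blk_mx m s S).
Proof.
move=> m1 s2 gS; have SL := gbs_subL gS.
have m0 : 0 < m by lia.
have s0 : 0 < s by lia.
have [/andP[t0 /allP wt] tm] := tmin_spec m0 s2 SL.
have live := gbs_live m1 s2 gS.
set t := tmin m s S in t0 wt tm live *.
have tE : t = t.-1.+1 by lia.
have zero i k : t.-1 < i -> k < m -> blk_mx m s S i k = 0.
  move=> ti km; apply/eqP; rewrite /blk_mx /blk_card cardfs_eq0.
  apply/negPn/negP => /fset0Pn [x]; rewrite mem_block // => /andP[/wt xt /eqP xd].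
  have : x %/ s < t * m by rewrite ltn_divLR // -mulnA.
  have : t * m <= i * m by rewrite leq_mul2r; lia.
  by rewrite xd; lia.
have lt_idx i k : i <= t.-1 -> k.+1 < m -> 1 <= (i * m + k).+1 < t * m.
  move=> it km; have : i * m <= t.-1 * m by rewrite leq_mul2r it orbT.
  by rewrite [X in _ < X * _]tE mulSn; lia.
have ndvd i k : k.+1 < m -> ~~ (m %| (i * m + k).+1).
  by move=> km; rewrite dvdn_block_index; lia.
split=> //; split=> //.
- move=> i k it km; apply: live.
  have : i.+1 * m <= t.-1 * m by rewrite leq_mul2r it orbT.
  by rewrite mulSn; lia.
- by apply: live; rewrite addn0.
- move=> i k km; case: (leqP i t.-1) => it; last by rewrite zero.
  by rewrite /blk_mx addnS; apply: (gbs2 gS); [apply: lt_idx | apply: ndvd].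
- move=> i k km pos; case: (leqP i.+1 t.-1) => it; last by rewrite zero in pos.
  move: pos; rewrite /blk_mx mulSn [m + _]addnC addnAC -addSn => pos.
  apply: (gbs3 gS) => //.
  have : i.+1 * m <= t.-1 * m by rewrite leq_mul2r it orbT.
  by rewrite mulSn -/t; lia.
- move=> u0; have := gbs6 gS; rewrite -/t /blk_mx addn0.
  have -> : (t.-2 * m + m.-1).+1 = t.-1 * m.
    by rewrite -addnS prednK // -mulSnr prednK.
  by apply; lia.
- by move=> i k km; apply: blk_mx_cap.
Qed.

Lemma gbs_block_le (m s i k : nat) (S : {fset nat}) :
  1 < m -> 2 < s -> gen_beta_set m s S -> k < m ->
  (2 * (\sum_(x <- block s S (i * m + k).+1) x)%N%:Z
   <= blkw m s i k (blk_mx m s S i k) (dshift m (blk_mx m s S i) k))%R.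
Proof.
move=> m1 s2 gS km; have SL := gbs_subL gS.
have m0 : 0 < m by lia.
have [t0 fa] := gbs_feas m1 s2 gS.
set a := blk_mx m s S in fa *.
have [z|pos] := posnP (a i k).
  have -> : block s S (i * m + k).+1 = fset0.
    by apply/eqP; rewrite -cardfs_eq0; apply/eqP.
  by rewrite z /blkw big_seq_fset0; lia.
have cap := feas_cap fa km pos.
have mx : blk_max s S (i * m + k).+1 + dshift m (a i) k <= s - 1 - i.
  have := blk_max_le i SL km; rewrite /dshift.
  case: (k =P m.-1) => [_|kl] /=; first lia.
  case: (a i k =P a i m.-1) => [e|_] /=; last lia.
  move=> _.
  have lm : m.-1 < m by lia.
  have it : i <= (tmin m s S).-1.
    by rewrite leqNgt; apply/negP => it; rewrite (feas_zero fa) in pos.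
  (* By monotonicity all sizes from column [k] to the last one agree, so condition (5) transports
     the maximum to the last block, whose bound is smaller by one. *)
  have ceq d : forall j, j + d = m.-1 -> k <= j ->
      blk_max s S (i * m + j).+1 = blk_max s S (i * m + m.-1).+1.
    elim: d => [|d IH] j je kj; first by rewrite -je addn0.
    rewrite -(IH j.+1); try lia.
    have e1 : a i j = a i k.
      have := @feas_row_le _ _ _ _ i k j fa; have := @feas_row_le _ _ _ _ i j m.-1 fa; lia.
    have e2 : a i j.+1 = a i k.
      have := @feas_row_le _ _ _ _ i k j.+1 fa; have := @feas_row_le _ _ _ _ i j.+1 m.-1 fa; lia.
    rewrite addnS; apply: (gbs5 gS).
    - have : i * m <= (tmin m s S).-1 * m by rewrite leq_mul2r it orbT.
      by rewrite -[X in _ < X * _](prednK t0) mulSn; lia.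
    - by rewrite dvdn_block_index; lia.
    - by move: e2; rewrite -e1 /a /blk_mx addnS.
    - by move: pos; rewrite -e2 /a /blk_mx addnS.
  have := blk_max_le i SL lm; rewrite (ceq (m.-1 - k) k) ?eqxx; try lia.
have hb x : x \in block s S (i * m + k).+1 ->
    x <= (i * m + k) * s + (s - 1 - i - dshift m (a i) k).
  move=> xb; have [xE _ _] := inL_in_block SL km xb.
  rewrite {1}xE leq_add2l; apply: leq_trans (_ : blk_max s S (i * m + k).+1 <= _); last lia.
  by rewrite /blk_max; apply: leq_bigmax_seq xb isT.
have := sum_uniq_le (fset_uniq _) hb.
rewrite -/(blk_card _ _ _) -/(blk_mx m s S i k) -/a /blkw.
move: (\sum_(x <- _) x) => w.
have dle : dshift m (a i) k <= 1 by rewrite /dshift; case: (_ || _).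
have tE : ((i * m + k) * s + (s - 1 - i - dshift m (a i) k) + (1 + i + dshift m (a i) k)
   = (i * m + k) * s + s)%N by lia.
move: tE; set T := (_ + (s - 1 - i - _))%N; set B := ((_ + _) * s + s)%N.
move: (dshift m (a i) k) pos => d pos tE; clearbody T B; clear -pos tE.
case: (a i k) pos => // n _ /=; nia.
Qed.

Lemma gbs_le_aval (m s : nat) (S : {fset nat}) :
  1 < m -> 2 < s -> gen_beta_set m s S -> (2 * fval S <= aval m s (blk_mx m s S))%R.
Proof.
move=> m1 s2 gS.
rewrite (@fval_double m s) ?lerD2r; try lia.
  by apply: ler_sum => i _; apply: ler_sum => k _; apply: gbs_block_le.
move=> x xS; have m0 : 0 < m by lia.
have /andP[_ h] := inL_bound m0 (gbs_subL gS xS).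
rewrite ltn_divLR; last lia.
apply: leq_trans h _; rewrite leq_mul2r; apply/orP; right.
by rewrite /bigN leq_mul2r; lia.
Qed.

(** * From arrays to sets *)

Definition blk_top (m s : nat) (a : nat -> nat -> nat) (i k : nat) : nat :=
  s - 1 - i - dshift m (a i) k.

(* Every block is filled downwards from the largest maximum that conditions (4)
   and (5) allow. *)
Definition canon_set (m s : nat) (a : nat -> nat -> nat) : {fset nat} :=
  [fset x in iota 0 (s * m * s) |
    let i := x %/ s %/ m in let k := x %/ s %% m in
    x %% s <= blk_top m s a i k < x %% s + a i k]%fset.

Lemma feas_cap_dshift (m s u i k : nat) (a : nat -> nat -> nat) :
  feas m s u a -> k < m -> 0 < a i k -> a i k + 2 * i + 1 + dshift m (a i) k <= s.
Proof.
move=> fa km pos; have := feas_cap fa km pos; rewrite /dshift.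
case: (k =P m.-1) => //= kl; case: (a i k =P a i m.-1) => //= e _.
have lm : m.-1 < m by lia.
by have := feas_cap fa (i := i) lm; rewrite -e eqxx; lia.
Qed.

Lemma dshift_le (m s u i k : nat) (a : nat -> nat -> nat) :
  feas m s u a -> k.+1 < m -> dshift m (a i) k <= dshift m (a i) k.+1.
Proof.
move=> fa km; rewrite /dshift.
have := feas_row fa i km; have := @feas_row_le _ _ _ _ i k.+1 m.-1 fa.
by case: (k =P m.-1); case: (k.+1 =P m.-1); case: (a i k =P a i m.-1);
  case: (a i k.+1 =P a i m.-1) => //=; lia.
Qed.

Lemma mem_canon_set (m s u i k r : nat) (a : nat -> nat -> nat) :
  feas m s u a -> k < m -> r < s ->
  ((i * m + k) * s + r \in canon_set m s a)
  = (r <= blk_top m s a i k < r + a i k).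
Proof.
move=> fa km rs.
have s0 : 0 < s by lia.
have m0 : 0 < m by lia.
rewrite !inE /= mem_iota /= divnMDl // (divn_small rs) addn0.
rewrite divnMDl // (divn_small km) addn0 modnMDl (modn_small rs) modnMDl (modn_small km).
case: (leqP (s * m * s) ((i * m + k) * s + r)) => [h|h] //=.
(* Outside the range of [iota] the row index is at least [s], where the capacity forces the block to
   be empty. *)
have si : s <= i.
  rewrite leqNgt; apply/negP => is_.
  have : (i * m + k).+1 * s <= s * m * s.
    rewrite leq_mul2r; apply/orP; right.
    have : i.+1 * m <= s * m by rewrite leq_mul2r is_ orbT.
    by rewrite mulSn; lia.
  by rewrite mulSn; lia.
have [->|pos] := posnP (a i k); first by rewrite addn0; case: leqP.
by have := feas_cap fa km pos; lia.
Qed.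

Lemma canon_set_ex (m s u x : nat) (a : nat -> nat -> nat) :
  0 < m -> 0 < s -> feas m s u a -> x \in canon_set m s a ->
  exists i k r, [/\ k < m, x = (i * m + k) * s + r, r < s
                  & r <= blk_top m s a i k < r + a i k].
Proof.
move=> m0 s0 fa xS; exists (x %/ s %/ m), (x %/ s %% m), (x %% s).
have km : x %/ s %% m < m by rewrite ltn_mod.
have rs : x %% s < s by rewrite ltn_mod.
split=> //; first by rewrite -!divn_eq.
by rewrite -(mem_canon_set _ fa) // -!divn_eq.
Qed.

Lemma canon_block (m s u i k : nat) (a : nat -> nat -> nat) :
  feas m s u a -> 0 < s -> k < m ->
  perm_eq (block s (canon_set m s a) (i * m + k).+1)
          [seq (i * m + k) * s + (blk_top m s a i k - j) | j <- iota 0 (a i k)].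
Proof.
move=> fa s0 km.
have top : 0 < a i k -> a i k + i <= blk_top m s a i k /\ blk_top m s a i k < s.
  by move=> pos; have := feas_cap_dshift fa km pos; rewrite /blk_top; lia.
apply: uniq_perm; first exact: fset_uniq.
  rewrite map_inj_in_uniq ?iota_uniq // => j j'; rewrite !mem_iota /= !add0n => hj hj'.
  by have := top; lia.
move=> x; rewrite mem_block //; apply/andP/mapP.
  case=> xS /eqP xd.
  have xE := divn_eq x s; rewrite xd in xE.
  have rs : x %% s < s by rewrite ltn_mod.
  move: xS; rewrite {1}xE (mem_canon_set _ fa) // => h.
  exists (blk_top m s a i k - x %% s); first by rewrite mem_iota /=; lia.
  by rewrite {1}xE; congr (_ + _); lia.
case=> j; rewrite mem_iota /= add0n => hj ->.
have rs : blk_top m s a i k - j < s by have := top; lia.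
rewrite (mem_canon_set _ fa) // divnMDl // divn_small // addn0 eqxx; split=> //.
by have := top; lia.
Qed.

Lemma canon_blk_card (m s u i k : nat) (a : nat -> nat -> nat) :
  feas m s u a -> 0 < s -> k < m -> blk_card s (canon_set m s a) (i * m + k).+1 = a i k.
Proof.
move=> fa s0 km; rewrite /blk_card (perm_size (canon_block i fa s0 km)).
by rewrite size_map size_iota.
Qed.

Lemma canon_blk_max (m s u i k : nat) (a : nat -> nat -> nat) :
  feas m s u a -> 0 < s -> k < m -> 0 < a i k ->
  blk_max s (canon_set m s a) (i * m + k).+1 = blk_top m s a i k.
Proof.
move=> fa s0 km pos; rewrite /blk_max (perm_big _ (canon_block i fa s0 km)) big_map /=.
have ts : blk_top m s a i k < s by rewrite /blk_top; lia.
apply/eqP; rewrite eqn_leq; apply/andP; split.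
  by apply/bigmax_leqP_seq => j _ _; rewrite modnMDl modn_small; lia.
have j0 : 0 \in iota 0 (a i k) by rewrite mem_iota.
apply: leq_trans (leq_bigmax_seq _ j0 isT).
by rewrite subn0 modnMDl modn_small.
Qed.

Lemma canon_block_sum (m s u i k : nat) (a : nat -> nat -> nat) :
  feas m s u a -> 0 < s -> k < m ->
  (2 * (\sum_(x <- block s (canon_set m s a) (i * m + k).+1) x)%N%:Z
   = blkw m s i k (a i k) (dshift m (a i) k))%R.
Proof.
move=> fa s0 km; rewrite (perm_big _ (canon_block i fa s0 km)) big_map /=.
have [->|pos] := posnP (a i k); first by rewrite big_nil /blkw; lia.
have capd := feas_cap_dshift fa km pos.
rewrite /blk_top /blkw; move: (dshift m (a i) k) capd => d capd.
move: (a i k) pos capd => n pos capd.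
have -> : iota 0 n = index_iota 0 n by rewrite /index_iota subn0.
rewrite big_mkord.
rewrite (big_morph Posz PoszD (erefl _)).
rewrite (eq_bigr (fun j : 'I_n =>
   (((i * m + k) * s + s)%N%:Z - (1 + i + d)%N%:Z) + (-1) * j%:Z)%R); last first.
  by move=> j _; have := ltn_ord j; lia.
by rewrite sum_affine; lia.
Qed.

Lemma canon_div_lt (m s u x : nat) (a : nat -> nat -> nat) :
  0 < m -> 0 < s -> feas m s u a -> x \in canon_set m s a -> x %/ s < u.+1 * m.
Proof.
move=> m0 s0 fa /(canon_set_ex m0 s0 fa) [i [k [r [km -> rs h]]]].
rewrite divnMDl // divn_small // addn0.
have iu : i <= u.
  by rewrite leqNgt; apply/negP => ui; move: h; rewrite (feas_zero fa) // addn0; lia.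
have : i.+1 * m <= u.+1 * m by rewrite leq_mul2r; lia.
by rewrite mulSn; lia.
Qed.

Lemma canon_inL (m s u x : nat) (a : nat -> nat -> nat) :
  0 < m -> 0 < s -> feas m s u a -> x \in canon_set m s a -> inL m s x.
Proof.
move=> m0 s0 fa /(canon_set_ex m0 s0 fa) [i [k [r [km -> rs h]]]].
apply/inL_block; exists i, k, r; split=> //.
  have pos : 0 < a i k by lia.
  by have := feas_cap_dshift fa km pos; move: h; rewrite /blk_top; lia.
have pos : 0 < a i k by lia.
have := feas_cap_dshift fa km pos; move: h; rewrite /blk_top.
have : (k == m.-1) <= dshift m (a i) k by rewrite /dshift; case: (k == m.-1).
lia.
Qed.

Lemma canon_tmin (m s u : nat) (a : nat -> nat -> nat) :
  1 < m -> 2 < s -> feas m s u a -> tmin m s (canon_set m s a) = u.+1.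
Proof.
move=> m1 s2 fa.
have m0 : 0 < m by lia.
have s0 : 0 < s by lia.
have [/andP[t0 /allP wt] tmi] := tmin_spec m0 s2 (fun x => canon_inL m0 s0 fa).
apply/eqP; rewrite eqn_leq; apply/andP; split.
  apply: tmi; apply/andP; split=> //; apply/allP => x /(canon_div_lt m0 s0 fa).
  by rewrite ltn_divLR // mulnA.
have pos := feas_pos0 fa.
have ts : blk_top m s a u 0 < s by rewrite /blk_top; lia.
have : (u * m + 0) * s + blk_top m s a u 0 \in canon_set m s a.
  by rewrite (mem_canon_set _ fa) // leqnn /=; lia.
move/wt; rewrite addn0 => h.
rewrite ltnNge; apply/negP => tu.
have : tmin m s (canon_set m s a) * (m * s) <= u * (m * s) by rewrite leq_mul2r tu orbT.
lia.
Qed.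

Lemma canon_gbs (m s u : nat) (a : nat -> nat -> nat) :
  1 < m -> 2 < s -> feas m s u a -> gen_beta_set m s (canon_set m s a).
Proof.
move=> m1 s2 fa.
have m0 : 0 < m by lia.
have s0 : 0 < s by lia.
have tE := canon_tmin m1 s2 fa.
have cardE i k (km : k < m) := canon_blk_card i fa s0 km.
have cardS i k : k.+1 < m -> blk_card s (canon_set m s a) (i * m + k).+2 = a i k.+1.
  by move=> km; rewrite -addnS cardE.
have maxE i k (km : k < m) := canon_blk_max (i := i) fa s0 km.
have maxS i k : k.+1 < m -> 0 < a i k.+1 ->
    blk_max s (canon_set m s a) (i * m + k).+2 = blk_top m s a i k.+1.
  by move=> km; rewrite -addnS => pos; rewrite maxE.
split; rewrite ?tE /=.
- apply/negP => /eqP S0.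
  have := cardE u 0 m0; rewrite S0 /blk_card /block => h.
  by have := feas_pos0 fa; rewrite -h (_ : [fset x in fset0 | _]%fset = fset0) ?cardfs0 //;
    apply/fsetP => x; rewrite !inE.
- by move=> x; apply: canon_inL fa.
- move=> j /andP[j1 _]; have [i [k [km ->]]] := block_index_split m0 j1.
  rewrite cardE // => z; case: (ltnP k.+1 m) => km'.
    by rewrite cardS //; have := feas_row fa i km'; lia.
  (* The next block opens row [i.+1]. If it were nonempty, row [i] would lie below the top row and
     could not contain an empty block. *)
  have -> : (i * m + k).+2 = (i.+1 * m + 0).+1 by rewrite mulSn; lia.
  rewrite cardE //; apply/eqP; rewrite -leqn0 leqNgt; apply/negP => pos.
  have iu : i < u.
    by rewrite ltnNge; apply/negP => ui; rewrite (feas_zero fa) in pos.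
  by have := feas_pos fa iu km; lia.
- move=> j /andP[j1 _]; have [i [k [km ->]]] := block_index_split m0 j1.
  rewrite dvdn_block_index // => km'; have {}km' : k.+1 < m by lia.
  by rewrite cardE // cardS //; apply: (feas_row fa).
- move=> j /andP[j1 _]; have [i [k [km ->]]] := block_index_split m0 j1.
  have -> : (i * m + k).+1 + m = (i.+1 * m + k).+1 by rewrite mulSn; lia.
  by rewrite !cardE //; apply: (feas_col fa).
- move=> j /andP[j1 _]; have [i [k [km ->]]] := block_index_split m0 j1.
  rewrite dvdn_block_index // => km'; have {}km' : k.+1 < m by lia.
  rewrite cardS // => pos.
  rewrite maxS // maxE //; last by have := feas_row fa i km'; lia.
  by have := dshift_le i fa km'; rewrite /blk_top; lia.
- move=> j /andP[j1 _]; have [i [k [km ->]]] := block_index_split m0 j1.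
  rewrite dvdn_block_index // => km'; have {}km' : k.+1 < m by lia.
  rewrite cardE // cardS // => e pos.
  rewrite maxS // maxE //; last lia.
  rewrite /blk_top; congr (_ - nat_of_bool _); rewrite e.
  (* For equal sizes the two shifts could differ only through the test for the last column; there
     block [k] has the size of the last block, so both are 1. *)
  case: (k.+1 =P m.-1) => [e'|_] /=; first by rewrite e' eqxx orbT.
  by have -> : (k == m.-1) = false by lia.
- move=> u0.
  have -> : u * m = (u.-1 * m + m.-1).+1.
    by rewrite -addnS prednK // -mulSnr prednK.
  have lm : m.-1 < m by lia.
  have -> : (u.-1 * m + m.-1).+2 = (u * m + 0).+1.
    by rewrite -(addnS _ m.-1) prednK // -mulSnr prednK ?addn0.
  by rewrite !cardE //; apply: (feas_six fa).
Qed.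

Lemma canon_fval (m s u : nat) (a : nat -> nat -> nat) :
  1 < m -> 2 < s -> feas m s u a -> (2 * fval (canon_set m s a) = aval m s a)%R.
Proof.
move=> m1 s2 fa.
have m0 : 0 < m by lia.
have s0 : 0 < s by lia.
rewrite (fval_double m0 s0); last first.
  move=> x /(canon_div_lt m0 s0 fa) h; apply: leq_trans h _.
  by rewrite leq_mul2r; have := feas_live_bound m1 fa; lia.
have -> : cnt m s (fun i k => blk_card s (canon_set m s a) (i * m + k).+1) = cnt m s a.
  by apply: eq_bigr => i _; apply: eq_bigr => k _; apply: canon_blk_card fa s0 _.
congr (_ - _)%R; apply: eq_bigr => i _; apply: eq_bigr => k _.
exact: canon_block_sum fa s0 _.
Qed.

(** The value of the array of S is only an upper bound for 2 f(S), but a competing array is realised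
    exactly by its canonical set, so maximality among sets passes to arrays. *)
Lemma gbs_opt (m s : nat) (S : {fset nat}) :
  1 < m -> 2 < s -> gen_beta_set m s S ->
  (forall S', gen_beta_set m s S' -> (fval S' <= fval S)%R) ->
  opt m s (tmin m s S).-1 (blk_mx m s S).
Proof.
move=> m1 s2 gS hmax; split; first by have [] := gbs_feas m1 s2 gS.
move=> u' a' fa'; apply: le_trans (gbs_le_aval m1 s2 gS).
by rewrite -(canon_fval m1 s2 fa') ler_pM2l //; apply: hmax; apply: canon_gbs fa'.
Qed.

Theorem theorem8p5 (s m : nat) (hs : 3 <= s) (hm : 2 <= m) (S : {fset nat})
    (hS : gen_beta_set m s S)
    (hmax : forall S' : {fset nat}, gen_beta_set m s S' ->
              (fval S' <= fval S)%R) :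
  let t := tmin m s S in
  let a := blk_card s S in
  (odd s ->
     t = (s - 1) %/ 2 /\
     ((forall i, (t - 1) * m + 1 <= i <= t * m -> a i = 1) \/
      ((forall i, (t - 1) * m + 1 <= i <= t * m - 1 -> a i = 2) /\
       a (t * m) = 1))) /\
  (~~ odd s ->
     t = s %/ 2 /\
     ((forall i, (t - 1) * m <= i <= t * m - 1 -> a i = 1) \/
      ((forall i, (t - 1) * m + 1 <= i <= t * m - 1 -> a i = 1) /\
       a ((t - 1) * m) = 2))).
Proof.
move=> t a.
have [t0 fa] := gbs_feas hm hs hS; rewrite -/t in t0 fa.
have oa := gbs_opt hm hs hS hmax; rewrite -/t in oa.
have tm : t * m = (t - 1) * m + m by rewrite -mulSnr; congr (_ * _); lia.
have t1 : t.-1 = t - 1 by lia.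
have rowE i : (t - 1) * m + 1 <= i <= (t - 1) * m + m ->
    a i = blk_mx m s S t.-1 (i - 1 - (t - 1) * m).
  rewrite /blk_mx t1 /a; move: ((t - 1) * m) => B hi.
  by congr (blk_card _ _ _); lia.
case: (opt_top_row hm oa) => [[sE h]|[sE h]]; split=> hodd; try lia.
  split; first lia.
  rewrite tm; case: h => [h|[h hl]].
    by left=> i hi; rewrite rowE; [apply: h; lia | lia].
  right; split; first by move=> i hi; rewrite rowE; [apply: h; lia | lia].
  rewrite rowE; last lia.
  by rewrite -hl; congr (blk_mx _ _ _ _ _); lia.
split; first lia.
(* An even [s] is at least 4, so there is a row below the top one, and block (t - 1) m is its last
   block. *)
have u0 : 0 < t.-1 by lia.
have lm : m.-1 < m by lia.
have lastE : a ((t - 1) * m) = blk_mx m s S t.-2 m.-1.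
  rewrite /blk_mx /a; congr (blk_card _ _ _).
  by rewrite -addnS prednK; [rewrite -mulSnr prednK; [congr (_ * _); lia | lia] | lia].
have pos : 0 < a ((t - 1) * m) by rewrite lastE; apply: (feas_pos fa); lia.
(* The last column in row t - 2 has capacity s - 2 (t - 2) - 2, which is 2 for s = 2 t. *)
have cap : a ((t - 1) * m) <= 2.
  have pos' := pos; rewrite lastE in pos'.
  by have := feas_cap fa lm pos'; rewrite -lastE eqxx; lia.
have top i : (t - 1) * m + 1 <= i <= t * m - 1 -> a i = 1.
  by rewrite tm => hi; rewrite rowE; [apply: h; lia | lia].
have [e|e] : a ((t - 1) * m) = 1 \/ a ((t - 1) * m) = 2 by lia.
  left=> i hi; case: (i =P (t - 1) * m) => [->//|ne].
  by apply: top; lia.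
by right; split.
Qed.
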